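(* Let $\mathbb S^2\times\mathbb S^2=\mathbb{CP}^1\times\mathbb{CP}^1$ be equipped with the usual product metric $g_0$ and the diagonal action of $G=\operatorname{SU}(2)$, with normal geodesic $$\gamma(t)=([\cos t:\sin t],[\cos t:-\sin t]),\qquad t\in[0,\tfrac{\pi}{4}].$$ Let $(g_s)_{s\ge 0}$ be the Cheeger deformation of $g_0$ along this action. Then there exists $t\in(0,\tfrac{\pi}{8})$ such that the orbit $\operatorname{SU}(2)\cdot\gamma(t)$ is a proper (i.e. non-minimal) biharmonic hypersurface of $(\mathbb S^2\times\mathbb S^2,g_1)$.
   Context: Let $Q$ be the biinvariant metric on $G=\operatorname{SU}(2)$ normalized so that, with $X^*$ the action field of $X\in\mathfrak{su}(2)$, one has $g_0(X^*,Y^* )_{|\gamma(t)}=Q(X,P_tY)$ for $X,Y\in\mathfrak{su}(2)$, $t\in(0,\frac\pi4)$, with $P_t=\operatorname{diag}(\sin^22t,\ 1,\ \cos^22t)$ in a suitable $Q$-orthonormal basis (the principal isotropy group is finite, so $\mathfrak n=\mathfrak{su}(2)$). Cheeger deformation: for $s>0$, $g_s$ is the unique metric on $M=\mathbb S^2\times\mathbb S^2$ for which $\rho:(M\times G,\,g_0\oplus\frac1sQ)\to(M,g_s)$, $\rho(p,a)=a^{-1}\cdot p$, is a Riemannian submersion. Equivalently, $g_s$ agrees with $g_0$ in the direction normal to the orbits (which remain perpendicular to $\gamma$), while on the orbits $g_s(X^*,Y^* )_{|\gamma(t)}=Q(X,P_{s,t}Y)$ with $P_{s,t}=P_t(\operatorname{Id}+sP_t)^{-1}$.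 A hypersurface is biharmonic if its inclusion $\phi$ (with the induced metric) is a critical point of the bienergy $E_2(\phi)=\frac12\int|\tau(\phi)|^2\,dV$, where $\tau$ is the tension field; equivalently $\tau_2(\phi)=-\Delta\tau(\phi)+\operatorname{Tr}R(\tau(\phi),d\phi)d\phi=0$ with $\Delta=\operatorname{Tr}(\nabla^\phi_\nabla-\nabla^\phi\nabla^\phi)$. It is proper biharmonic if in addition $\tau(\phi)\ne0$. *)

(* Defs.v *)
From HB Require Import structures.
From mathcomp Require Import all_boot all_order all_algebra.
From mathcomp Require Import complex.
From mathcomp Require Import all_classical all_reals all_analysis.
From mathcomp Require Import ring lra.

Set Implicit Arguments.
Unset Strict Implicit.
Unset Printing Implicit Defensive.

Import Order.TTheory GRing.Theory Num.Theory.
Import numFieldNormedType.Exports.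

Local Open Scope classical_set_scope.
Local Open Scope ring_scope.
Local Open Scope complex_scope.
Local Open Scope sesquilinear_scope.

Definition partial (R : realType) (n : nat) (W : normedModType R)
    (i : 'I_n) (f : 'rV[R]_n -> W) : 'rV[R]_n -> W :=
  fun x => 'D_(delta_mx 0 i) f x.

(* C^infinity: all iterated partial derivatives are Frechet differentiable. *)
Definition smooth_on (R : realType) (n : nat) (W : normedModType R)
    (U : set 'rV[R]_n) (f : 'rV[R]_n -> W) : Prop :=
  forall (s : seq 'I_n) (x : 'rV[R]_n), U x ->
    differentiable (foldr (fun i h => partial i h) f s) x.

Section Coordinates.
Variable R : realType.

(* Christoffel symbol Gamma^k_{ij} of the metric with coefficients [g]. *)
Definition christoffel (n : nat) (g : 'rV[R]_n -> 'M[R]_n) (k i j : 'I_n)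
    (x : 'rV[R]_n) : R :=
  2^-1 * \sum_l invmx (g x) k l *
    (partial i (fun y => g y j l) x + partial j (fun y => g y i l) x
     - partial l (fun y => g y i j) x).

(* R(d_i, d_j) d_l = sum_k (curvature g k l i j) d_k, with
   R(X, Y) = [nabla_X, nabla_Y] - nabla_[X, Y]. *)
Definition curvature (n : nat) (g : 'rV[R]_n -> 'M[R]_n) (k l i j : 'I_n)
    (x : 'rV[R]_n) : R :=
  partial i (christoffel g k j l) x - partial j (christoffel g k i l) x
  + \sum_m (christoffel g k i m x * christoffel g m j l x
            - christoffel g k j m x * christoffel g m i l x).

Variables (m n : nat).
Implicit Types (g : 'rV[R]_n -> 'M[R]_n) (phi : 'rV[R]_m -> 'rV[R]_n).

Definition induced_metric g phi : 'rV[R]_m -> 'M[R]_m := fun u =>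
  \matrix_(a, b) (partial a phi u *m g (phi u) *m (partial b phi u)^T) 0 0.

(* nabla^phi_{d_a} V, for a section V of phi^* T(R^n). *)
Definition pullback_nabla g phi (a : 'I_m) (V : 'rV[R]_m -> 'rV[R]_n) :
    'rV[R]_m -> 'rV[R]_n := fun u =>
  partial a V u + \row_k \sum_i \sum_j
    christoffel g k i j (phi u) * partial a phi u 0 i * V u 0 j.

Definition tension g phi : 'rV[R]_m -> 'rV[R]_n := fun u =>
  let h := induced_metric g phi in
  \sum_a \sum_b invmx (h u) a b *:
    (pullback_nabla g phi a (partial b phi) u
     - \sum_c christoffel h c a b u *: partial c phi u).

(* Delta = Tr (nabla^phi_nabla - nabla^phi nabla^phi): the nonnegative sign. *)
Definition rough_laplacian g phi (V : 'rV[R]_m -> 'rV[R]_n) :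
    'rV[R]_m -> 'rV[R]_n := fun u =>
  let h := induced_metric g phi in
  \sum_a \sum_b invmx (h u) a b *:
    (\sum_c christoffel h c a b u *: pullback_nabla g phi c V u
     - pullback_nabla g phi a (pullback_nabla g phi b V) u).

(* Tr R(V, dphi) dphi. *)
Definition curvature_trace g phi (V : 'rV[R]_m -> 'rV[R]_n) :
    'rV[R]_m -> 'rV[R]_n := fun u =>
  let h := induced_metric g phi in
  \sum_a \sum_b invmx (h u) a b *:
    \row_k \sum_i \sum_j \sum_l curvature g k l i j (phi u) *
      V u 0 i * partial a phi u 0 j * partial b phi u 0 l.

Definition bitension g phi : 'rV[R]_m -> 'rV[R]_n := fun u =>
  - rough_laplacian g phi (tension g phi) u
  + curvature_trace g phi (tension g phi) u.

End Coordinates.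

Section SU2Action.
Variable R : realType.
Local Notation C := R[i].
Local Notation Rec := (@complex.Re R).
Local Notation Imc := (@complex.Im R).

(* R^3 x R^3, a pair of vectors being the two rows of a matrix. *)
Definition space := 'M[R]_(2, 3).

Definition S2xS2 : set space := [set p | forall i, \sum_j p i j ^+ 2 = 1].

Definition tangent (p : space) : set space :=
  [set v | forall i, \sum_j p i j * v i j = 0].

(* The unit sphere is identified with CP^1: the unit vector q corresponds to
   the line in C^2 onto which [projector q] is the orthogonal projection. *)
Definition projector (q : 'rV[R]_3) : 'M[C]_2 :=
  \matrix_(i < 2, j < 2)
    if i == 0 then
      if j == 0 then ((1 + q 0 2%:R) / 2)%:C else (q 0 0 / 2) -i* (q 0 1 / 2)
    else
      if j == 0 then (q 0 0 / 2) +i* (q 0 1 / 2) else ((1 - q 0 2%:R) / 2)%:C.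

Definition bloch (H : 'M[C]_2) : 'rV[R]_3 :=
  \row_(j < 3) [:: 2 * Rec (H 1 0); 2 * Imc (H 1 0); Rec (H 0 0 - H 1 1)]`_j.

(* The point of the sphere representing the line [v_0 : v_1], for v != 0. *)
Definition of_line (v : 'cV[C]_2) : 'rV[R]_3 :=
  bloch ((\tr (v *m v ^t*))^-1 *: (v *m v ^t*)).

Definition SU2 : set 'M[C]_2 := [set a | a *m a ^t* = 1%:M /\ \det a = 1].

Definition su2 : set 'M[C]_2 := [set X | X ^t* = - X /\ \tr X = 0].

(* If q represents the line L then [rotate a q] represents a L; see
   [rotate_of_line]. *)
Definition rotate (a : 'M[C]_2) (q : 'rV[R]_3) : 'rV[R]_3 :=
  bloch (a *m projector q *m a ^t*).

(* The diagonal action. *)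
Definition su2_act (a : 'M[C]_2) (p : space) : space :=
  \matrix_(i < 2) rotate a (row i p).

(* The action field X^* at p: the derivative of [su2_act (exp (s X)) p] at
   s = 0. *)
Definition action_field (X : 'M[C]_2) (p : space) : space :=
  \matrix_(i < 2)
    bloch (X *m projector (row i p) - projector (row i p) *m X).

(* The biinvariant metric on SU(2), at the identity; see [Q_normalized] for
   the normalization. *)
Definition Q (X Y : 'M[C]_2) : R := - 4 * Rec (\tr (X *m Y)).

Definition normal_geodesic (t : R) : space :=
  \matrix_(i < 2)
    of_line (\col_(k < 2) [:: (cos t)%:C; ((-1) ^+ i * sin t)%:C]`_k).

Definition su2_orbit (p : space) : set space := [set su2_act a p | a in SU2].

Lemma projector_bloch (H : 'M[C]_2) :
  H ^t* = H -> \tr H = 1 -> projector (bloch H) = H.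
Proof.
move=> hH; rewrite /mxtrace !big_ord_recr big_ord0 /= add0r => hT.
have e00 := congr1 (fun M : 'M[C]_2 => M 0 0) hH.
have e11 := congr1 (fun M : 'M[C]_2 => M 1 1) hH.
have e10 := congr1 (fun M : 'M[C]_2 => M 1 0) hH.
rewrite !mxE in e00 e11 e10.
have i0 : widen_ord (leqnSn 1) ord_max = 0 :> 'I_2 by apply/val_inj.
have i1 : ord_max = 1 :> 'I_2 by apply/val_inj.
rewrite i0 i1 in hT.
case E00 : (H 0 0) e00 hT => [x y]; case E11 : (H 1 1) e11 => [z w].
case E10 : (H 1 0) e10 => [u v]; case E01 : (H 0 1) => [r k].
move=> [e1 e2] [e3] [e4] [e5 e6].
apply/matrixP=> i j; rewrite !mxE /=.
have [->|->] : i = 0 \/ i = 1.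
  by case: i => [[|[|//]] hi]; [left|right]; apply/val_inj.
all: have [->|->] : j = 0 \/ j = 1 by
  case: j => [[|[|//]] hj]; [left|right]; apply/val_inj.
all: rewrite /= ?E00 ?E11 ?E10 ?E01 /=; apply/eqP; rewrite eq_complex /=;
  apply/andP; split; apply/eqP; lra.
Qed.

Lemma rotate_of_line (a : 'M[C]_2) (v : 'cV[C]_2) : SU2 a -> v != 0 ->
  rotate a (of_line v) = of_line (a *m v).
Proof.
move=> [aa _] v0; have {}aa : a ^t* *m a = 1%:M by apply: mulmx1C.
have trH : \tr (v *m v ^t*) != 0.
  apply: contra v0 => /eqP; rewrite mxtrace_mulC trace_mx11 mxE => /eqP.
  under eq_bigr do rewrite !mxE -normCKC.
  rewrite psumr_eq0 => [/allP h|i _]; last exact: exprn_ge0.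
  apply/eqP/matrixP=> i j; rewrite ord1 mxE; apply/eqP.
  by have := h i (mem_index_enum _); rewrite /= expf_eq0 normr_eq0.
have hH : (v *m v ^t*) ^t* = v *m v ^t* by rewrite trmx_mul map_mxM trmxCK.
have hT : Num.conj (\tr (v *m v ^t*)) = \tr (v *m v ^t*).
  by rewrite -{2}hH trace_map_mx mxtrace_tr.
rewrite /rotate projector_bloch; last 2 first.
- by rewrite linearZ /= map_mxZ hH fmorphV /= hT.
- by rewrite linearZ /= mulVf.
congr bloch; rewrite -scalemxAr -scalemxAl trmx_mul map_mxM; congr (_^-1 *: _).
  by rewrite [RHS]mxtrace_mulC -mulmxA (mulmxA (a ^t*)) aa mul1mx mxtrace_mulC.
by rewrite !mulmxA.
Qed.

(* The basis below is the suitable one in which P_t is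
   diag (sin^2 2t, 1, cos^2 2t). *)
Lemma Q_normalized : exists E : 'I_3 -> 'M[C]_2,
  [/\ forall i, su2 (E i), forall i j, Q (E i) (E j) = (i == j)%:R
    & forall t i j, let p := normal_geodesic t in
        \sum_k \sum_l action_field (E i) p k l * action_field (E j) p k l =
        (i == j)%:R * [:: sin (2 * t) ^+ 2; 1; cos (2 * t) ^+ 2]`_i].
Proof.
pose c : R := (Num.sqrt 8)^-1.
have c2 : c ^+ 2 = 8^-1 by rewrite exprVn sqr_sqrtr.
have I3 (i : 'I_3) : [\/ i = 0, i = 1 | i = 2%:R].
  by case: i => [[|[|[|//]]] hi]; [apply: Or31|apply: Or32|apply: Or33];
    apply/val_inj.
have sumE t (A : 'I_3 -> space) : (forall a k l, A a k l = 2 * c *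
    nth 0 (nth [::] [:: [:: 0; (-1) ^+ k * sin (2 * t); 0];
                        [:: cos (2 * t); 0; - ((-1) ^+ k * sin (2 * t))];
                        [:: 0; - cos (2 * t); 0]] a) l) ->
    forall i j, \sum_k \sum_l A i k l * A j k l =
      (i == j)%:R * [:: sin (2 * t) ^+ 2; 1; cos (2 * t) ^+ 2]`_i.
  move=> AE i j; transitivity (8 * c ^+ 2 * ((i == j)%:R * nth 0
      [:: sin (2 * t) ^+ 2; cos (2 * t) ^+ 2 + sin (2 * t) ^+ 2;
          cos (2 * t) ^+ 2] i)).
    rewrite !big_ord_recr !big_ord0 /= !AE {A AE}.
    by case: (I3 i) => ->; case: (I3 j) => -> /=; ring.
  by rewrite c2 divff ?mul1r ?cos2Dsin2 // pnatr_eq0.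
pose E (i : 'I_3) : 'M[C]_2 := \matrix_(k < 2, l < 2)
  nth 0 [:: (if k == l then (0 +i* (if k == 0 then - c else c)) else 0);
            (if k == l then 0 else ((if k == 0 then - c else c) +i* 0));
            (if k == l then 0 else (0 +i* - c)) ] i.
have I2 (i : 'I_2) : i = 0 \/ i = 1.
  by case: i => [[|[|//]] hi]; [left|right]; apply/val_inj.
exists E; split.
- move=> i; split.
    apply/matrixP=> k l; rewrite !mxE.
    case: (I3 i) => ->; case: (I2 k) => ->; case: (I2 l) => -> /=;
    by apply/eqP; rewrite eq_complex /= ?oppr0 ?opprK ?eqxx.
  rewrite /mxtrace !big_ord_recr big_ord0 /= !mxE.
  case: (I3 i) => -> /=; apply/eqP; rewrite eq_complex /=; apply/andP; split;
   apply/eqP; lra.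
- move=> i j; rewrite /Q /mxtrace !big_ord_recr big_ord0 /= !mxE.
  rewrite !big_ord_recr !big_ord0 /= !mxE.
  case: (I3 i) => ->; case: (I3 j) => -> /=; nra.
move=> t i j p.
have of_lineE (x y : R) : x ^+ 2 + y ^+ 2 = 1 ->
    of_line (\col_(k < 2) [:: x%:C; y%:C]`_k) =
    \row_k [:: 2 * x * y; 0; x ^+ 2 - y ^+ 2]`_k.
  move=> xy; rewrite /of_line.
  have -> : \tr ((\col_(k < 2) [:: x%:C; y%:C]`_k : 'cV[C]_2) *m
      (\col_(k < 2) [:: x%:C; y%:C]`_k) ^t*) = 1.
    rewrite /mxtrace !big_ord_recr big_ord0 /= !mxE.
    rewrite !big_ord_recr !big_ord0 /= !mxE /=.
    by apply/eqP; rewrite eq_complex /=; apply/andP; split; apply/eqP; nra.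
  rewrite invr1 scale1r; apply/rowP=> k; rewrite !mxE.
  by case: (I3 k) => -> /=; rewrite !big_ord_recr !big_ord0 /= !mxE /=; ring.
have rowp k : row k p =
    \row_l [:: (-1) ^+ k * sin (2 * t); 0; cos (2 * t)]`_l.
  rewrite rowK of_lineE; last first.
    by rewrite exprMn sqrr_sign mul1r cos2Dsin2.
  have -> : 2 * t = t + t by ring.
  apply/rowP=> l; rewrite !mxE sinD cosD.
  by case: (I2 k) => ->; case: (I3 l) => -> /=; ring.
have fieldE a k l : action_field (E a) p k l = 2 * c *
    nth 0 (nth [::] [:: [:: 0; (-1) ^+ k * sin (2 * t); 0];
                        [:: cos (2 * t); 0; - ((-1) ^+ k * sin (2 * t))];
                        [:: 0; - cos (2 * t); 0]] a) l.
  rewrite mxE rowp !mxE; case: (I3 l) => -> /=;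
  rewrite ?mxE ?big_ord_recr ?big_ord0 /= ?mxE /=;
  case: (I3 a) => -> /=; by field.
exact: (sumE t (fun a => action_field (E a) p)).
Qed.

End SU2Action.

Section Metrics.
Variable R : realType.
Local Notation space := (space R).

(* [chart U F]: F is the inverse of a coordinate chart of S^2 x S^2. As both
   dimensions are 4, F is a diffeomorphism onto an open subset by the inverse
   function theorem. *)
Definition chart (U : set 'rV[R]_4) (F : 'rV[R]_4 -> space) : Prop :=
  [/\ open U, smooth_on U F, forall x, U x -> S2xS2 (F x),
      forall x y, U x -> U y -> F x = F y -> x = y
    & forall x, U x -> forall c : 'rV[R]_4,
        \sum_i c 0 i *: partial i F x = 0 -> c = 0].

(* [g p u v] is meaningful for p in S^2 x S^2 and u, v tangent at p. *)
Definition metric := space -> space -> space -> R.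

Definition coefficients (g : metric) (F : 'rV[R]_4 -> space) :
    'rV[R]_4 -> 'M[R]_4 := fun x =>
  \matrix_(i, j) g (F x) (partial i F x) (partial j F x).

Definition riemannian (g : metric) : Prop :=
  (forall p, S2xS2 p ->
    [/\ forall u v, tangent p u -> tangent p v -> g p u v = g p v u,
        forall (c : R) u v w, tangent p u -> tangent p v -> tangent p w ->
          g p (c *: u + v) w = c * g p u w + g p v w
      & forall u, tangent p u -> u != 0 -> 0 < g p u u]) /\
  (forall U F, chart U F -> smooth_on U (coefficients g F)).

(* The product of the round metrics. *)
Definition product_metric : metric :=
  fun _ u v => \sum_i \sum_j u i j * v i j.

Definition rho (p : space) (a : 'M[R[i]]_2) : space := su2_act (invmx a) p.

(* The tangent space of M x SU(2) at (p, a) consists of the pairs (w, a X) with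
   w tangent at p and X in su(2).  [lift_metric] is g_0 + Q/s on such pairs, and
   [drho] is the differential of rho there, as
   rho (p, a exp (e X)) = exp (- e X) . (a^-1 . p) and [su2_act (invmx a)] is
   linear. *)
Definition lift_metric (s : R) (p w : space) (X : 'M[R[i]]_2) (w' : space)
    (X' : 'M[R[i]]_2) : R :=
  product_metric p w w' + s^-1 * Q X X'.

Definition drho (p : space) (a : 'M[R[i]]_2) (w : space) (X : 'M[R[i]]_2) :
    space :=
  su2_act (invmx a) w - action_field X (rho p a).

Definition horizontal (s : R) (p : space) (a : 'M[R[i]]_2) (w : space)
    (X : 'M[R[i]]_2) : Prop :=
  [/\ tangent p w, su2 X
    & forall w' X', tangent p w' -> su2 X' -> drho p a w' X' = 0 ->
        lift_metric s p w X w' X' = 0].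

(* rho is onto and so is each differential (take X = 0). *)
Definition rho_riemannian_submersion (s : R) (g : metric) : Prop :=
  forall p a, S2xS2 p -> SU2 a -> forall w X w' X',
    horizontal s p a w X -> horizontal s p a w' X' ->
    g (rho p a) (drho p a w X) (drho p a w' X') = lift_metric s p w X w' X'.

Definition cheeger_deformation (g : R -> metric) : Prop :=
  (forall p u v, S2xS2 p -> tangent p u -> tangent p v ->
     g 0 p u v = product_metric p u v) /\
  (forall s, 0 < s -> riemannian (g s) /\ rho_riemannian_submersion s (g s)).

(* [slice c] parametrizes the hyperplane on which the first coordinate is c,
   and a slice chart represents S as such a hyperplane; in a slice chart, the
   inclusion of S into S^2 x S^2 reads [slice c]. *)
Definition slice (c : R) (u : 'rV[R]_3) : 'rV[R]_4 :=
  row_mx (c%:M : 'rV[R]_1) u.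

Definition slice_chart (S : set space) (U : set 'rV[R]_4)
    (F : 'rV[R]_4 -> space) (c : R) : Prop :=
  chart U F /\ forall x, U x -> (S (F x) <-> x 0 0 = c).

(* The tension and bitension fields of the inclusion are sections of the
   pull-back of the tangent bundle, so that whether they vanish at a point can
   be decided in any one slice chart around that point. *)
Definition biharmonic_hypersurface (g : metric) (S : set space) : Prop :=
  forall p, S p -> exists U F c,
    [/\ slice_chart S U F c,
        exists2 u, U (slice c u) & F (slice c u) = p
      & forall u, U (slice c u) ->
          bitension (coefficients g F) (slice c) u = 0].

Definition nonminimal (g : metric) (S : set space) : Prop :=
  exists U F c u, [/\ slice_chart S U F c, U (slice c u)
    & tension (coefficients g F) (slice c) u != 0].

Definition proper_biharmonic_hypersurface (g : metric) (S : set space) : Prop :=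
  biharmonic_hypersurface g S /\ nonminimal g S.

End Metrics.

(* Main.v *)
(** Write s = sin 2t and k = cos 2t. Along the normal geodesic g_1 is
    8 dt^2 + sum_K f_K(t) (theta^K)^2, where the theta^K are the left-invariant
    forms read through three Euler angles and f = 2 P / (1 + P) with
    P = (k^2, 1, s^2). In the resulting slice charts the tension field of an orbit
    is a constant T times d_t with T = - 1/16 sum_K f_K' / f_K, and all second
    derivative terms of the bitension field cancel but T h^{ab} d_t Gamma^k_{ab}.
    Its tangential part vanishes because the group is unimodular, its normal part
    is - T / 16 sum_K f_K'' / f_K. The latter sum is a positive multiple of a
    polynomial in y = s^2 that is positive at y = 0 and negative at y = 1/2, so it
    has a zero with 0 < t < pi / 8; there s < k, hence T is nonzero. *)

Require Import Defs.
From mathcomp Require Import all_boot all_order all_algebra.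
From mathcomp Require Import complex.
From mathcomp Require Import all_classical all_reals all_analysis.
From mathcomp Require Import ring lra.

Set Implicit Arguments.
Unset Strict Implicit.
Unset Printing Implicit Defensive.

Import Order.TTheory GRing.Theory Num.Theory.
Import numFieldNormedType.Exports.

Local Open Scope classical_set_scope.
Local Open Scope ring_scope.
Local Open Scope complex_scope.
Local Open Scope sesquilinear_scope.

(** * Differentiability: locality, and the chain rule through real functions *)

Section Differentiation.
Variables (R : realType) (V : normedModType R).

(** The identity (L_X nabla)(Y, Z) = nabla^2_{Y,Z} X + R(X, Y) Z with X = d_t explains why a single
    term of the bitension field survives: the coordinate components of L_{d_t} nabla are the d_t
    Gamma^k_{ab}. The inverse metric is not differentiated in that term. Once it is frozen at the
    slice, the contracted tangential symbols do not depend on t at all and the normal one is linear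
    in the f_K'; hence f_K'' / f_K without any square of f_K' / f_K. The metric g_1 is known only
    through its values on images of horizontal vectors, so each frame vector needs an explicit
    horizontal lift; finding it amounts to dividing the K-th component by 1 + P_K. The factor 2 in
    f_K arises because Q is twice the dot product of angular velocities, and the 8 because each
    sphere is traversed at speed 2. Derivatives are limits of difference quotients and charts have
    to be C^infinity. A class of functions stable under partial derivatives supplies the product
    rules and the smoothness together. *)

Lemma near_eq_differentiable (W : normedModType R) (f g : V -> W) x :
  (\near x, f x = g x) -> differentiable f x -> differentiable g x.
Proof.
move=> fg df; have [cdf /eqaddoP Ef] := (diff_locallyP _ _).1 df.
have fg0 := (nbhs0P _ _).1 fg.
suff Eg : g \o shift x = cst (g x) + 'd f x +o_ 0 id.
  by apply/diff_locallyP; rewrite (diff_unique cdf Eg).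
apply/eqaddoP => e e0; have := Ef e e0; apply: filter_app; near=> h.
rewrite /= !fctE /=; suff -> : f (h + x) = g (h + x).
  by rewrite (nbhs_singleton fg).
by rewrite addrC; near: h.
Unshelve. all: by end_near. Qed.

Lemma differentiable_comp_real (phi : R -> R) (f : V -> R) x :
  differentiable f x -> derivable phi (f x) 1 -> differentiable (phi \o f) x.
Proof.
by move=> df /derivable1_diffP dphi; exact: differentiable_comp.
Qed.

Lemma derive_comp_real (phi : R -> R) (f : V -> R) x v :
  differentiable f x -> derivable phi (f x) 1 ->
  'D_v (phi \o f) x = derive1 phi (f x) * 'D_v f x.
Proof.
move=> df dphi; have /derivable1_diffP dphi' := dphi.
rewrite !deriveE //; last exact: differentiable_comp.
rewrite diff_comp //=; move/deriv1E: dphi => ->.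
by rewrite mulrC.
Qed.

End Differentiation.

Section Partial.
Variables (R : realType) (n : nat).
Implicit Types (i : 'I_n) (x : 'rV[R]_n).

Lemma partial_eq (W : normedModType R) (U : set 'rV[R]_n) i
    (f g : 'rV[R]_n -> W) x :
  open U -> U x -> (forall y, U y -> f y = g y) -> partial i f x = partial i g x.
Proof.
move=> oU Ux fg; apply: near_eq_derive; near=> y.
by apply: fg; near: y; exact: open_nbhs_nbhs.
Unshelve. all: by end_near. Qed.

Lemma partial_cst (W : normedModType R) i (w : W) x :
  partial i (fun=> w) x = 0.
Proof. exact: derive_cst. Qed.

Lemma partial_coord i j x :
  partial i (fun y => y 0 j) x = (i == j)%:R.
Proof.
rewrite /partial deriveE; last exact: differentiable_coord.
have @f : {linear 'rV[R]_n -> R}.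
  by exists (fun N : 'rV[R]_n => N 0 j); do 2![eexists]; do ?[constructor];
     rewrite ?mxE// => ? *; rewrite ?mxE//; move=> ?; rewrite !mxE.
rewrite (_ : (fun _ => _) = f) // diff_lin; last exact: coord_continuous.
by rewrite /= mxE eqxx /= eq_sym.
Qed.

End Partial.

Arguments partial_eq {R n W U i f g x}.

(** * A class of smooth functions closed under partial derivatives *)

Section Elementary.
Variables (R : realType) (n : nat) (U : set 'rV[R]_n).

(** Smoothness quantifies over all iterated partial derivatives, so a class that contains its own
    partial derivatives reduces it to first-order differentiability. The last constructor is
    essential: derivative formulas and inverse matrices are known only up to equality on U, where
    denominators do not vanish. *)
Inductive elementary : ('rV[R]_n -> R) -> Prop :=
| elementary_cst c : elementary (fun=> c)
| elementary_coord j : elementary (fun x => x 0 j)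
| elementaryD f g : elementary f -> elementary g -> elementary (fun x => f x + g x)
| elementaryM f g : elementary f -> elementary g -> elementary (fun x => f x * g x)
| elementaryV f : (forall x, U x -> f x != 0) -> elementary f ->
    elementary (fun x => (f x)^-1)
| elementary_sin f : elementary f -> elementary (fun x => sin (f x))
| elementary_cos f : elementary f -> elementary (fun x => cos (f x))
| elementary_eq f g : (forall x, U x -> f x = g x) -> elementary f ->
    elementary g.

Lemma elementaryN f : elementary f -> elementary (fun x => - f x).
Proof.
move=> ef; apply: (elementary_eq _ (elementaryM (elementary_cst (-1)) ef)).
by move=> x _; rewrite mulN1r.
Qed.

Lemma elementaryB f g :
  elementary f -> elementary g -> elementary (fun x => f x - g x).
Proof. by move=> ef eg; apply: elementaryD => //; exact: elementaryN. Qed.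

Lemma elementary_sum (I : Type) (r : seq I) (f : I -> 'rV[R]_n -> R) :
  (forall i, elementary (f i)) -> elementary (fun x => \sum_(i <- r) f i x).
Proof.
move=> ef; elim: r => [|i r IHr].
  by apply: (elementary_eq _ (elementary_cst 0)) => x _; rewrite big_nil.
by apply: (elementary_eq _ (elementaryD (ef i) IHr)) => x _; rewrite big_cons.
Qed.

Hypothesis openU : open U.

Lemma elementary_differentiable f x :
  elementary f -> U x -> differentiable f x.
Proof.
move=> ef; elim: ef x => {f}.
- by move=> c x _; exact: differentiable_cst.
- by move=> j x _; exact: differentiable_coord.
- by move=> f g _ df _ dg x Ux; apply: differentiableD; [exact: df|exact: dg].
- by move=> f g _ df _ dg x Ux; apply: differentiableM; [exact: df|exact: dg].
- by move=> f f0 _ df x Ux; apply: differentiableV; [exact: df|exact: f0].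
- by move=> f _ df x Ux; apply: differentiable_comp_real;
    [exact: df|exact: derivable_sin].
- by move=> f _ df x Ux; apply: differentiable_comp_real;
    [exact: df|exact: derivable_cos].
- move=> f g fg _ df x Ux; apply: (@near_eq_differentiable _ _ _ f).
    by near=> y; apply: fg; near: y; exact: open_nbhs_nbhs.
  exact: df.
Unshelve. all: by end_near. Qed.

Lemma elementary_derivable f x v :
  elementary f -> U x -> derivable f x v.
Proof.
by move=> ef Ux; apply: diff_derivable; exact: elementary_differentiable.
Qed.

Section Rules.
Variables (i : 'I_n) (x : 'rV[R]_n) (f g : 'rV[R]_n -> R).
Hypotheses (Ux : U x) (ef : elementary f) (eg : elementary g).

Lemma partialD : partial i (fun y => f y + g y) x = partial i f x + partial i g x.
Proof. by apply: deriveD; exact: elementary_derivable. Qed.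

Lemma partialM :
  partial i (fun y => f y * g y) x = partial i f x * g x + f x * partial i g x.
Proof.
rewrite /partial deriveM; last 2 first; try exact: elementary_derivable.
by rewrite addrC; congr (_ + _); rewrite mulrC.
Qed.

Lemma partialN : partial i (fun y => - f y) x = - partial i f x.
Proof. by apply: deriveN; exact: elementary_derivable. Qed.

Lemma partialV : f x != 0 ->
  partial i (fun y => (f y)^-1) x = - (f x ^- 2 * partial i f x).
Proof.
move=> f0; rewrite /partial deriveV //; last exact: elementary_derivable.
by rewrite [LHS]scaleNr.
Qed.

Lemma partial_sin : partial i (fun y => sin (f y)) x = cos (f x) * partial i f x.
Proof.
have [_ dsin] := is_derive_sin (f x).
rewrite -dsin -derive1E; apply: derive_comp_real.
  exact: elementary_differentiable.
exact: derivable_sin.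
Qed.

Lemma partial_cos : partial i (fun y => cos (f y)) x = - sin (f x) * partial i f x.
Proof.
have [_ dcos] := is_derive_cos (f x).
rewrite -dcos -derive1E; apply: derive_comp_real.
  exact: elementary_differentiable.
exact: derivable_cos.
Qed.

End Rules.

Lemma partial_sum (I : Type) (r : seq I) (f : I -> 'rV[R]_n -> R) i x :
  U x -> (forall j, elementary (f j)) ->
  partial i (fun y => \sum_(j <- r) f j y) x = \sum_(j <- r) partial i (f j) x.
Proof.
move=> Ux ef; elim: r => [|j r IHr].
  by under eq_fun do rewrite big_nil; rewrite big_nil partial_cst.
under eq_fun do rewrite big_cons.
by rewrite big_cons partialD // ?IHr //; exact: elementary_sum.
Qed.

(** Each differentiation rule yields an expression built with the same constructors; openness of U
    lets an equality on U be differentiated. *)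
Lemma elementary_partial i f : elementary f -> elementary (partial i f).
Proof.
move=> ef; elim: ef => {f}.
- move=> c; apply: (elementary_eq _ (elementary_cst 0)) => x _.
  by rewrite partial_cst.
- move=> j; apply: (elementary_eq _ (elementary_cst (i == j)%:R)) => x _.
  by rewrite partial_coord.
- move=> f g ef IHf eg IHg; apply: (elementary_eq _ (elementaryD IHf IHg)).
  by move=> x Ux; rewrite partialD.
- move=> f g ef IHf eg IHg; apply: (elementary_eq _
    (elementaryD (elementaryM IHf eg) (elementaryM ef IHg))).
  by move=> x Ux; rewrite partialM.
- move=> f f0 ef IHf; have eV := elementaryV f0 ef.
  apply: (elementary_eq _ (elementaryN (elementaryM (elementaryM eV eV) IHf))).
  by move=> x Ux; rewrite partialV ?f0 // expr2 invfM.
- move=> f ef IHf; apply: (elementary_eq _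
    (elementaryM (elementary_cos ef) IHf)).
  by move=> x Ux; rewrite partial_sin.
- move=> f ef IHf; apply: (elementary_eq _
    (elementaryM (elementaryN (elementary_sin ef)) IHf)).
  by move=> x Ux; rewrite partial_cos.
- move=> f g fg _ IHf; apply: (elementary_eq _ IHf) => x Ux.
  exact: partial_eq fg.
Qed.

End Elementary.

Section ElementaryMatrix.
Variables (R : realType) (n : nat) (U : set 'rV[R]_n).
Hypothesis openU : open U.

Definition elementary_mx m p (A : 'rV[R]_n -> 'M[R]_(m, p)) : Prop :=
  forall i j, elementary U (fun x => A x i j).

Lemma elementary_mx_cst m p (A : 'M[R]_(m, p)) : elementary_mx (fun=> A).
Proof. by move=> i j; exact: elementary_cst. Qed.

Lemma elementary_mx_mul m p q (A : 'rV[R]_n -> 'M[R]_(m, p))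
    (B : 'rV[R]_n -> 'M[R]_(p, q)) :
  elementary_mx A -> elementary_mx B -> elementary_mx (fun x => A x *m B x).
Proof.
move=> eA eB i j; apply: (@elementary_eq _ _ _ (fun x => \sum_k A x i k * B x k j)).
  by move=> x _; rewrite mxE.
by apply: elementary_sum => k; apply: elementaryM; [exact: eA|exact: eB].
Qed.

Lemma partial_mxE m p (A : 'rV[R]_n -> 'M[R]_(m, p)) i x :
  U x -> elementary_mx A ->
  partial i A x = \matrix_(k, l) partial i (fun y => A y k l) x.
Proof.
move=> Ux eA; rewrite /partial derive_mx //.
by apply/derivable_mxP => k l; apply: (elementary_derivable openU).
Qed.

Lemma partial_mulmx m p q (A : 'rV[R]_n -> 'M[R]_(m, p))
    (B : 'rV[R]_n -> 'M[R]_(p, q)) i x :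
  U x -> elementary_mx A -> elementary_mx B ->
  partial i (fun y => A y *m B y) x = partial i A x *m B x + A x *m partial i B x.
Proof.
move=> Ux eA eB; rewrite !partial_mxE //; last exact: elementary_mx_mul.
apply/matrixP => k l; rewrite !mxE -big_split /=.
under eq_fun do rewrite mxE.
rewrite (partial_sum openU) => // [|j]; last by apply: elementaryM; [exact: eA|exact: eB].
apply: eq_bigr => j _; rewrite (partialM openU) // !mxE //.
Qed.

Lemma elementary_mx_partial m p (A : 'rV[R]_n -> 'M[R]_(m, p)) i :
  elementary_mx A -> elementary_mx (partial i A).
Proof.
move=> eA k l; apply: (elementary_eq _ (elementary_partial openU i (eA k l))).
by move=> x Ux; rewrite partial_mxE // mxE.
Qed.

Lemma elementary_mx_differentiable m p (A : 'rV[R]_n -> 'M[R]_(m, p)) x :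
  U x -> elementary_mx A -> differentiable A x.
Proof.
move=> Ux eA; rewrite (_ : A = \sum_k \sum_l (fun y => A y k l *: delta_mx k l)).
  apply: differentiable_sum => k; apply: differentiable_sum => l.
  by apply: differentiableZl; exact: (elementary_differentiable openU).
apply/funext => y; rewrite [LHS]matrix_sum_delta fct_sumE.
by apply: eq_bigr => k _; rewrite fct_sumE.
Qed.

Lemma elementary_mx_smooth m p (A : 'rV[R]_n -> 'M[R]_(m, p)) :
  elementary_mx A -> smooth_on U A.
Proof.
move=> eA s x Ux; apply: elementary_mx_differentiable => //.
by elim: s => //= i s; exact: elementary_mx_partial.
Qed.

End ElementaryMatrix.

(** * Coordinate slices of R^4 and derivatives along them *)

Section Slice.
Variable R : realType.

Definition transversal : 'I_4 := lshift 3 (ord0 : 'I_1).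
Definition tangential (a : 'I_3) : 'I_4 := rshift 1 a.

Lemma eq_tangential a b : (tangential a == tangential b) = (a == b).
Proof. by apply: inj_eq; exact: (@rshift_inj 1 3). Qed.

Lemma I4P (i : 'I_4) : i = transversal \/ exists a, i = tangential a.
Proof.
case: (split_ordP (i : 'I_(1 + 3))) => a ->; [left|by right; exists a].
by rewrite (ord1 a).
Qed.

Lemma sum_I4 (V : zmodType) (F : 'I_4 -> V) :
  \sum_i F i = F transversal + \sum_a F (tangential a).
Proof. by rewrite (@big_split_ord _ _ _ 1 3) big_ord1. Qed.

Lemma slice_transversal (c : R) u : slice c u 0 transversal = c.
Proof. by rewrite [LHS](@row_mxEl _ 1 1 3) mxE. Qed.

Lemma slice_tangential (c : R) u a : slice c u 0 (tangential a) = u 0 a.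
Proof. exact: (@row_mxEr _ 1 1 3). Qed.

Lemma slice_shift (c h : R) a u :
  slice c (h *: delta_mx 0 a + u) = h *: delta_mx 0 (tangential a) + slice c u.
Proof.
apply/rowP => i; have [->|[b ->]] := I4P i.
  rewrite slice_transversal [RHS]mxE slice_transversal !mxE andbF.
  by rewrite mulr0 add0r.
rewrite slice_tangential [RHS]mxE slice_tangential !mxE eqxx /=.
by rewrite eq_tangential.
Qed.

(** The difference quotients themselves coincide, and therefore so do their limits. *)
Lemma partial_slice (W : normedModType R) (f : 'rV[R]_4 -> W) c a u :
  partial a (fun v => f (slice c v)) u = partial (tangential a) f (slice c u).
Proof.
rewrite /partial /derive; congr (lim _); apply: (congr1 (fun F => F @ 0^')).
by apply/funext => h; rewrite /= slice_shift.
Qed.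

Lemma partial_slice_id (c : R) a u :
  partial a (slice c) u = delta_mx 0 (tangential a).
Proof.
rewrite (partial_slice id); exact: derive_id.
Qed.

Lemma elementary_mx_slice (c : R) : elementary_mx setT (slice c).
Proof.
move=> i j; rewrite (ord1 i); have [->|[a ->]] := I4P j.
  apply: (elementary_eq _ (elementary_cst _ c)) => u _.
  by rewrite slice_transversal.
apply: (elementary_eq _ (elementary_coord _ a)) => u _.
by rewrite slice_tangential.
Qed.

Lemma open_slice (U : set 'rV[R]_4) c : open U -> open (slice c @^-1` U).
Proof.
move=> oU; apply: open_comp => // u _; apply: differentiable_continuous.
exact: (elementary_mx_differentiable openT I (@elementary_mx_slice c)).
Qed.

End Slice.

(** * Tension and bitension of a slice for a metric kappa dt^2 + h *)

Section TransverselyFlatMetric.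
Variables (R : realType) (g : 'rV[R]_4 -> 'M[R]_4) (h : 'rV[R]_4 -> 'M[R]_3).
Variables (U : set 'rV[R]_4) (kappa c : R).
Hypotheses (openU : open U) (kappa0 : kappa != 0).
Hypothesis gE : forall x, U x -> g x = block_mx (kappa%:M : 'M[R]_1) 0 0 (h x).
Hypothesis h_sym : forall x, U x -> (h x)^T = h x.
Hypothesis h_unit : forall x, U x -> h x \in unitmx.
Hypotheses (eh : elementary_mx U h) (ehV : elementary_mx U (fun x => invmx (h x))).

Local Notation z := transversal.
Local Notation r := tangential.

Lemma g_zz x : U x -> g x z z = kappa.
Proof. by move=> Ux; rewrite gE // [LHS](@block_mxEul _ 1 3 1 3) mxE. Qed.
Lemma g_zr x a : U x -> g x z (r a) = 0.
Proof. by move=> Ux; rewrite gE // [LHS](@block_mxEur _ 1 3 1 3) mxE. Qed.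
Lemma g_rz x a : U x -> g x (r a) z = 0.
Proof. by move=> Ux; rewrite gE // [LHS](@block_mxEdl _ 1 3 1 3) mxE. Qed.
Lemma g_rr x a b : U x -> g x (r a) (r b) = h x a b.
Proof. by move=> Ux; rewrite gE // [LHS](@block_mxEdr _ 1 3 1 3). Qed.

Lemma g_sym x i j : U x -> g x i j = g x j i.
Proof.
move=> Ux; have [->|[a ->]] := I4P i; have [->|[b ->]] := I4P j => //.
- by rewrite g_zr // g_rz.
- by rewrite g_zr // g_rz.
- by rewrite !g_rr // -{1}h_sym // mxE.
Qed.

Lemma invg x : U x -> invmx (g x) = block_mx (kappa^-1%:M : 'M[R]_1) 0 0 (invmx (h x)).
Proof.
move=> Ux; rewrite gE // [LHS](@invmx_block_diag _ 1 3) ?invmx_scalar //.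
by rewrite unitmxE det_ublock det_scalar1 unitrM unitfE kappa0 -unitmxE h_unit.
Qed.

Lemma invg_zz x : U x -> invmx (g x) z z = kappa^-1.
Proof. by move=> Ux; rewrite invg // [LHS](@block_mxEul _ 1 3 1 3) mxE. Qed.
Lemma invg_zr x a : U x -> invmx (g x) z (r a) = 0.
Proof. by move=> Ux; rewrite invg // [LHS](@block_mxEur _ 1 3 1 3) mxE. Qed.
Lemma invg_rz x a : U x -> invmx (g x) (r a) z = 0.
Proof. by move=> Ux; rewrite invg // [LHS](@block_mxEdl _ 1 3 1 3) mxE. Qed.
Lemma invg_rr x a b : U x -> invmx (g x) (r a) (r b) = invmx (h x) a b.
Proof. by move=> Ux; rewrite invg // [LHS](@block_mxEdr _ 1 3 1 3). Qed.

Lemma partial_g_zz x k : U x -> partial k (fun y => g y z z) x = 0.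
Proof.
move=> Ux; rewrite -(partial_cst k kappa x).
by apply: (partial_eq openU Ux) => y; exact: g_zz.
Qed.
Lemma partial_g_zr x k a : U x -> partial k (fun y => g y z (r a)) x = 0.
Proof.
move=> Ux; rewrite -(partial_cst k 0 x).
by apply: (partial_eq openU Ux) => y; exact: g_zr.
Qed.
Lemma partial_g_rz x k a : U x -> partial k (fun y => g y (r a) z) x = 0.
Proof.
move=> Ux; rewrite -(partial_cst k 0 x).
by apply: (partial_eq openU Ux) => y; exact: g_rz.
Qed.
Lemma partial_g_rr x k a b : U x ->
  partial k (fun y => g y (r a) (r b)) x = partial k (fun y => h y a b) x.
Proof.
by move=> Ux; apply: (partial_eq openU Ux) => y; exact: g_rr.
Qed.

Let partial_g := (partial_g_zz, partial_g_zr, partial_g_rz, partial_g_rr).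

Lemma elementary_g : elementary_mx U g.
Proof.
move=> i j; have [->|[a ->]] := I4P i; have [->|[b ->]] := I4P j.
- apply: (elementary_eq _ (elementary_cst _ kappa)) => x; by move/g_zz.
- apply: (elementary_eq _ (elementary_cst _ 0)) => x; by move/g_zr ->.
- apply: (elementary_eq _ (elementary_cst _ 0)) => x; by move/g_rz ->.
- by apply: (elementary_eq _ (eh a b)) => x Ux; rewrite g_rr.
Qed.

Lemma elementary_invg : elementary_mx U (fun x => invmx (g x)).
Proof.
move=> i j; have [->|[a ->]] := I4P i; have [->|[b ->]] := I4P j.
- apply: (elementary_eq _ (elementary_cst _ kappa^-1)) => x; by move/invg_zz.
- apply: (elementary_eq _ (elementary_cst _ 0)) => x; by move/invg_zr ->.
- apply: (elementary_eq _ (elementary_cst _ 0)) => x; by move/invg_rz ->.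
- by apply: (elementary_eq _ (ehV a b)) => x Ux; rewrite invg_rr.
Qed.

Lemma elementary_christoffel k i j : elementary U (christoffel g k i j).
Proof.
apply: elementaryM; first exact: elementary_cst.
apply: elementary_sum => l; apply: elementaryM; first exact: elementary_invg.
apply: elementaryB; first apply: elementaryD.
all: by apply: elementary_partial => //; exact: elementary_g.
Qed.

Lemma christoffelC k i j x : U x -> christoffel g k i j x = christoffel g k j i x.
Proof.
move=> Ux; congr (_ * _); apply: eq_bigr => l _; congr (_ * (_ - _)).
  exact: addrC.
by apply: (partial_eq openU Ux) => y; exact: g_sym.
Qed.

(** This is the second fundamental form of the slices, as a coefficient of the coordinate field. *)
Lemma christoffel_zrr a b x : U x ->
  christoffel g z (r a) (r b) x = - (2 * kappa)^-1 * partial z (fun y => h y a b) x.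
Proof.
move=> Ux; rewrite /christoffel sum_I4 big1 => [|l _]; last first.
  by rewrite invg_zr // mul0r.
rewrite invg_zz // !partial_g // invfM; ring.
Qed.

(** The transversal coordinate lines are geodesics. This removes the one product of Christoffel
    symbols that has no counterpart in [bitensionE]. *)
Lemma christoffel_zz k x : U x -> christoffel g k z z x = 0.
Proof.
move=> Ux; rewrite /christoffel sum_I4 !partial_g // big1 => [|l _].
  ring.
rewrite !partial_g //; ring.
Qed.

Lemma christoffel_rrr k a b x : U x ->
  christoffel g (r k) (r a) (r b) x = 2^-1 * \sum_l invmx (h x) k l *
    (partial (r a) (fun y => h y b l) x + partial (r b) (fun y => h y a l) x
     - partial (r l) (fun y => h y a b) x).
Proof.
move=> Ux; rewrite /christoffel sum_I4 invg_rz // mul0r add0r.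
congr (_ * _); apply: eq_bigr => l _.
by rewrite invg_rr // !partial_g.
Qed.

Local Notation V := (slice c @^-1` U).

Lemma induced_metricE u : V u -> induced_metric g (slice c) u = h (slice c u).
Proof.
move=> Vu; apply/matrixP => a b; rewrite mxE !partial_slice_id.
by rewrite -rowE trmx_delta -colE !mxE g_rr.
Qed.

Lemma induced_christoffel k a b u : V u ->
  christoffel (induced_metric g (slice c)) k a b u =
  christoffel g (r k) (r a) (r b) (slice c u).
Proof.
move=> Vu; rewrite christoffel_rrr // /christoffel induced_metricE //.
congr (_ * _); apply: eq_bigr => l _; congr (_ * (_ + _ - _));
  rewrite -partial_slice; apply: (partial_eq (open_slice openU) Vu) => v Vv;
  by rewrite induced_metricE.
Qed.

Lemma pullback_nablaE a (W : 'rV[R]_3 -> 'rV[R]_4) u k : V u ->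
  pullback_nabla g (slice c) a W u 0 k = partial a W u 0 k +
    \sum_j christoffel g k (r a) j (slice c u) * W u 0 j.
Proof.
move=> Vu; rewrite !mxE; congr (_ + _).
rewrite (bigD1 (r a)) //= [X in _ + X]big1 => [|i ia].
  rewrite addr0; apply: eq_bigr => j _.
  by rewrite partial_slice_id mxE !eqxx mulr1.
apply: big1 => j _.
by rewrite partial_slice_id mxE (negbTE ia) andbF mulr0 mul0r.
Qed.

(** A trace, not an average, and the coefficient of the coordinate field d_t, whose squared length
    is kappa, rather than of a unit normal. *)
Definition mean_curvature u : R :=
  \sum_a \sum_b invmx (h (slice c u)) a b * christoffel g z (r a) (r b) (slice c u).

(** In adapted coordinates the second derivatives of the inclusion vanish, and by
    [induced_christoffel] the tangential ambient symbols cancel against the induced ones. Only the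
    trace of the second fundamental form is left. *)
Lemma tensionE u : V u ->
  tension g (slice c) u = mean_curvature u *: delta_mx 0 z.
Proof.
move=> Vu; apply/rowP => k; rewrite /tension /= induced_metricE //.
rewrite summxE !mxE eqxx /= mulr_suml; apply: eq_bigr => a _.
rewrite summxE mulr_suml; apply: eq_bigr => b _.
rewrite mxE [X in _ * X]mxE pullback_nablaE //.
have -> : partial a (partial b (slice c)) u = 0.
  rewrite -[RHS](partial_cst a (delta_mx 0 (r b) : 'rV[R]_4) u).
  by apply: (partial_eq openT I) => v _; exact: partial_slice_id.
rewrite mxE add0r partial_slice_id (bigD1 (r b)) //= big1 => [|j jb]; last first.
  by rewrite mxE (negbTE jb) andbF mulr0.
rewrite mxE !eqxx mulr1 addr0 -mulrA; congr (_ * _).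
rewrite !mxE summxE.
under eq_bigr do rewrite mxE induced_christoffel // partial_slice_id mxE eqxx /=.
have [->|[d ->]] := I4P k.
  rewrite eqxx mulr1 big1 ?subr0 // => d _.
  by rewrite mulr0.
rewrite (bigD1 d) //= big1 => [|e ed]; last first.
  by rewrite eq_tangential eq_sym (negbTE ed) mulr0.
by rewrite eqxx mulr1 addr0 subrr mulr0.
Qed.

Variable T : R.
Hypothesis mean_curvatureE : forall u, V u -> mean_curvature u = T.

Lemma tension_cst u : V u -> tension g (slice c) u = T *: delta_mx 0 z.
Proof. by move=> Vu; rewrite tensionE // mean_curvatureE. Qed.

Lemma nabla_tension b u : V u ->
  pullback_nabla g (slice c) b (tension g (slice c)) u =
  \row_k (T * christoffel g k (r b) z (slice c u)).
Proof.
move=> Vu; apply/rowP => k; rewrite pullback_nablaE // [RHS]mxE.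
have -> : partial b (tension g (slice c)) u = 0.
  rewrite -[RHS](partial_cst b (T *: delta_mx 0 z : 'rV[R]_4) u).
  by apply: (partial_eq (open_slice openU) Vu) => v Vv; exact: tension_cst.
rewrite mxE add0r tension_cst // (bigD1 z) //= big1 => [|j jz].
  by rewrite !mxE !eqxx mulr1 addr0 mulrC.
by rewrite !mxE (negbTE jz) andbF !mulr0.
Qed.

Lemma nabla2_tension a b u k : V u ->
  pullback_nabla g (slice c) a
    (pullback_nabla g (slice c) b (tension g (slice c))) u 0 k =
  T * (partial (r a) (christoffel g k (r b) z) (slice c u) +
    \sum_j christoffel g k (r a) j (slice c u) *
      christoffel g j (r b) z (slice c u)).
Proof.
move=> Vu; rewrite pullback_nablaE // mulrDr; congr (_ + _); last first.
  rewrite mulr_sumr; apply: eq_bigr => j _; rewrite nabla_tension // mxE; ring.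
rewrite (partial_eq (open_slice openU) Vu (nabla_tension b)).
rewrite (partial_slice (fun y => \row_k (T * christoffel g k (r b) z y))).
have eG l : elementary U (fun y => T * christoffel g l (r b) z y).
  by apply: elementaryM; [exact: elementary_cst|exact: elementary_christoffel].
rewrite (partial_mxE openU) //; last first.
  by move=> i j; apply: (elementary_eq _ (eG j)) => y _; rewrite mxE.
rewrite mxE; under eq_fun do rewrite mxE.
rewrite (partialM openU) ?partial_cst ?mul0r ?add0r //.
  exact: elementary_cst.
exact: elementary_christoffel.
Qed.

(** As the tension field is T d_t with T constant, the bitension field is T times the trace of
    nabla^2 d_t + R(d_t, .)., that is, of the Lie derivative of the connection along d_t. The trace
    uses the induced connection instead of the ambient one; the difference is a multiple of
    nabla_{d_t} d_t, which is zero. *)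
Lemma bitensionE u k : V u -> bitension g (slice c) u 0 k =
  T * \sum_a \sum_b invmx (h (slice c u)) a b *
    partial z (christoffel g k (r a) (r b)) (slice c u).
Proof.
move=> Vu; rewrite /bitension /rough_laplacian /curvature_trace /=.
rewrite induced_metricE // [LHS]mxE [X in X + _]mxE !summxE mulr_sumr -sumrN.
rewrite -big_split; apply: eq_bigr => a _ /=.
rewrite !summxE mulr_sumr -sumrN -big_split; apply: eq_bigr => b _ /=.
set x := slice c u.
rewrite [X in - X + _]mxE [X in - (_ * X)]mxE [X in - (_ * (_ + X))]mxE nabla2_tension //.
have -> : (\sum_d christoffel (induced_metric g (slice c)) d a b u *:
    pullback_nabla g (slice c) d (tension g (slice c)) u) 0 k =
  T * \sum_d christoffel g (r d) (r a) (r b) x * christoffel g k (r d) z x.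
  rewrite summxE mulr_sumr; apply: eq_bigr => d _.
  rewrite mxE induced_christoffel // nabla_tension // mxE -/x; ring.
have -> : (invmx (h x) a b *: (\row_k0 \sum_i \sum_j \sum_l
      curvature g k0 l i j x * tension g (slice c) u 0 i *
      partial a (slice c) u 0 j * partial b (slice c) u 0 l)) 0 k =
    T * invmx (h x) a b * curvature g k (r b) z (r a) x.
  rewrite !mxE (bigD1 z) //= [X in _ + X]big1 => [|i iz]; last first.
    apply: big1 => j _; apply: big1 => l _.
    by rewrite tension_cst // !mxE (negbTE iz) andbF !mulr0 !mul0r.
  rewrite (bigD1 (r a)) //= [X in _ + X + _]big1 => [|i ia]; last first.
    apply: big1 => l _.
    by rewrite partial_slice_id !mxE (negbTE ia) andbF mulr0 mul0r.
  rewrite (bigD1 (r b)) //= [X in _ + X + _ + _]big1 => [|i ib]; last first.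
    by rewrite !partial_slice_id !mxE (negbTE ib) andbF mulr0.
  rewrite tension_cst // !partial_slice_id !mxE !eqxx /=; ring.
rewrite /curvature.
(* Symmetry of the lower indices makes the tangential derivative inside the curvature cancel the one
   produced by the second covariant derivative; the quadratic terms then cancel in pairs. *)
have -> : partial (r a) (christoffel g k z (r b)) x =
    partial (r a) (christoffel g k (r b) z) x.
  by apply: (partial_eq openU Vu) => y Uy; exact: christoffelC.
rewrite sumrB !sum_I4 christoffel_zz // mul0r add0r.
rewrite (christoffelC z z (r b)) //.
under [X in _ + _ + (X - _)]eq_bigr => m _ do
  rewrite (christoffelC k z (r m)) // mulrC.
under [X in _ + _ + (_ - (_ + X))]eq_bigr => m _ do
  rewrite (christoffelC (r m) z (r b)) //.
rewrite -/x; set s1 := \sum_m _; set s2 := \sum_m _.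
move: (invmx _ _ _) (partial (r a) _ _) (partial z _ _) => H p q.
by move: (christoffel _ _ _ _ _) (christoffel _ z _ _ _) => C D; ring.
Qed.

End TransverselyFlatMetric.

Lemma exchange_big2 (V : zmodType) (I J : finType) (F : I -> I -> J -> J -> V) :
  \sum_a \sum_b \sum_l \sum_k F a b l k = \sum_l \sum_k \sum_a \sum_b F a b l k.
Proof.
under eq_bigr do rewrite exchange_big /=.
rewrite exchange_big /=; apply: eq_bigr => l _.
by under eq_bigr do rewrite exchange_big /=; rewrite exchange_big.
Qed.

(** * Derivatives across the slices as derivatives in one real variable *)

Section TransversalDerivative.
Variable R : realType.

Lemma slice_line (t : R) u :
  slice t u = t *: delta_mx 0 transversal + slice 0 u.
Proof.
apply/rowP => i; rewrite [RHS]mxE; have [->|[b ->]] := I4P i.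
  by rewrite !slice_transversal !mxE !eqxx mulr1 addr0.
by rewrite !slice_tangential !mxE /= mulr0 add0r.
Qed.

Lemma partial_transversal (W : normedModType R) (f : 'rV[R]_4 -> W) c u :
  partial transversal f (slice c u) = 'D_1 (fun t => f (slice t u)) c.
Proof.
rewrite /partial /derive; congr (lim _); apply: (congr1 (fun F => F @ 0^')).
apply/funext => h /=; rewrite (slice_line (h *: 1 + c)) scalerDl -addrA.
by rewrite -slice_line [h *: 1]mulr1.
Qed.

Lemma near_slice (U : set 'rV[R]_4) (c : R) u :
  open U -> U (slice c u) -> \forall t \near c, U (slice t u).
Proof.
move=> oU Uc; have cs : {for c, continuous (fun t => slice t u)}.
  rewrite (_ : (fun t => slice t u) = (fun t => t *: delta_mx 0 transversal + slice 0 u)).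
    by apply: cvgD; [exact: scalel_continuous|exact: cvg_cst].
  by apply/funext => t; exact: slice_line.
by apply: cs; exact: open_nbhs_nbhs.
Qed.

End TransversalDerivative.

(** * Metrics that are diagonal in a coframe independent of the transversal coordinate *)

Section FrameMetric.
Variables (R : realType) (g : 'rV[R]_4 -> 'M[R]_4) (h : 'rV[R]_4 -> 'M[R]_3).
Variables (U : set 'rV[R]_4) (kappa c : R).
Hypotheses (openU : open U) (kappa0 : kappa != 0).
Hypothesis gE : forall x, U x -> g x = block_mx (kappa%:M : 'M[R]_1) 0 0 (h x).
Variables (theta : 'rV[R]_3 -> 'M[R]_3) (f f1 f2 : R -> 'rV[R]_3).
Hypothesis hE : forall t u, U (slice t u) ->
  h (slice t u) = (theta u)^T *m diag_mx (f t) *m theta u.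
Hypothesis etheta : elementary_mx setT theta.
Hypothesis theta_unit : forall t u, U (slice t u) -> theta u \in unitmx.
Hypothesis f_neq0 : forall t u K, U (slice t u) -> f t 0 K != 0.
Hypothesis df : forall (t : R) K, is_derive t 1 (fun s => f s 0 K) (f1 t 0 K).
Hypothesis df1 : forall (t : R) K, is_derive t 1 (fun s => f1 s 0 K) (f2 t 0 K).
(* The K-th frame vector has no contraction with the differential of the K-th
   coframe form: this makes the frame geodesic, whatever f is. *)
Hypothesis theta_unimodular : forall t u K l, U (slice t u) ->
  \sum_a invmx (theta u) a K *
    (partial a (fun v => theta v K l) u - partial l (fun v => theta v K a) u) = 0.
Hypotheses (eh : elementary_mx U h) (ehV : elementary_mx U (fun x => invmx (h x))).

Local Notation z := transversal.
Local Notation r := tangential.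

Lemma frame_metricE t u a b : U (slice t u) ->
  h (slice t u) a b = \sum_K f t 0 K * theta u K a * theta u K b.
Proof.
move=> Ut; rewrite hE // mxE; apply: eq_bigr => K _.
by rewrite mul_mx_diag !mxE mulrC (mulrC (theta u K a)) mulrC.
Qed.

Lemma frame_metric_sym x : U x -> (h x)^T = h x.
Proof.
have -> : x = slice (x 0 z) (\row_a x 0 (r a)).
  apply/rowP => i; have [->|[a ->]] := I4P i.
    by rewrite slice_transversal.
  by rewrite slice_tangential mxE.
by move=> Ux; rewrite hE // !trmx_mul trmxK tr_diag_mx mulmxA.
Qed.

Lemma frame_metric_unit x : U x -> h x \in unitmx.
Proof.
have -> : x = slice (x 0 z) (\row_a x 0 (r a)).
  apply/rowP => i; have [->|[a ->]] := I4P i.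
    by rewrite slice_transversal.
  by rewrite slice_tangential mxE.
move=> Ux; rewrite hE // !unitmx_mul unitmx_tr (theta_unit Ux) andbT /=.
rewrite unitmxE det_diag unitfE; apply/prodf_neq0 => K _.
exact: f_neq0 Ux.
Qed.

(** Raising the index of theta^K gives the dual frame vector e_K divided by f_K; the columns of
    [invmx (theta u)] are the e_K. *)
Lemma inv_frame_metric t u : U (slice t u) ->
  invmx (h (slice t u)) *m (theta u)^T =
  invmx (theta u) *m diag_mx (\row_K (f t 0 K)^-1).
Proof.
move=> Ut; have tu := theta_unit Ut; have hu := frame_metric_unit Ut.
apply: (can_inj (mulKmx hu)); rewrite mulKVmx // hE // -!mulmxA mulKVmx //.
rewrite -[LHS]mulmx1; congr (_ *m _); apply/esym/matrixP => i j.
rewrite mul_diag_mx !mxE; case: eqP => [->|_]; last by rewrite mulr0.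
by rewrite mulr1n mulfV // (f_neq0 _ Ut).
Qed.

Lemma inv_frame_metricl t u a K : U (slice t u) ->
  \sum_b invmx (h (slice t u)) a b * theta u K b =
  invmx (theta u) a K / f t 0 K.
Proof.
move=> /inv_frame_metric/matrixP/(_ a K); rewrite mul_mx_diag !mxE => <-.
by apply: eq_bigr => b _; rewrite mxE.
Qed.

Lemma inv_frame_metricC t u a b : U (slice t u) ->
  invmx (h (slice t u)) a b = invmx (h (slice t u)) b a.
Proof. by move=> Ut; rewrite -{1}frame_metric_sym // -trmx_inv mxE. Qed.

Lemma inv_frame_metricr t u b K : U (slice t u) ->
  \sum_a invmx (h (slice t u)) a b * theta u K a =
  invmx (theta u) b K / f t 0 K.
Proof.
move=> Ut; rewrite -inv_frame_metricl //; apply: eq_bigr => a _.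
by rewrite inv_frame_metricC.
Qed.

Lemma trace_frame t u K : U (slice t u) ->
  \sum_a \sum_b invmx (h (slice t u)) a b * (theta u K a * theta u K b) =
  (f t 0 K)^-1.
Proof.
move=> Ut; under eq_bigr => a _.
  under eq_bigr do rewrite mulrCA.
  rewrite -mulr_sumr inv_frame_metricl // mulrA.
  over.
rewrite -mulr_suml.
have /matrixP/(_ K K) := mulmxV (theta_unit Ut); rewrite !mxE eqxx => ->.
by rewrite mul1r.
Qed.

Lemma partial_tangential_frame_metric t u a b l : U (slice t u) ->
  partial (r a) (fun y => h y b l) (slice t u) =
  \sum_K f t 0 K * (partial a (fun v => theta v K b) u * theta u K l +
                    theta u K b * partial a (fun v => theta v K l) u).
Proof.
move=> Ut; rewrite -(partial_slice (fun y => h y b l)).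
rewrite (partial_eq (open_slice openU) Ut (fun v => @frame_metricE t v b l)).
have eK K m := etheta K m.
rewrite (partial_sum openT) // => [|K]; last first.
  by apply: elementaryM => //; apply: elementaryM => //; exact: elementary_cst.
apply: eq_bigr => K _.
under eq_fun do rewrite -mulrA.
rewrite (partialM openT) //; last 2 first.
- exact: elementary_cst.
- exact: elementaryM.
by rewrite partial_cst mul0r add0r (partialM openT).
Qed.

Lemma partial_transversal_frame_metric t u a b : U (slice t u) ->
  partial z (fun y => h y a b) (slice t u) =
  \sum_K f1 t 0 K * (theta u K a * theta u K b).
Proof.
move=> Ut; rewrite partial_transversal.
have -> : 'D_1 (fun s => h (slice s u) a b) t =
    'D_1 (\sum_K (fun s => f s 0 K * (theta u K a * theta u K b))) t.
  apply: near_eq_derive; near=> s.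
  rewrite frame_metricE; last by near: s; exact: near_slice.
  by rewrite fct_sumE; apply: eq_bigr => K _; rewrite mulrA.
have dK K : is_derive t 1 (fun s => f s 0 K * (theta u K a * theta u K b))
    (f1 t 0 K * (theta u K a * theta u K b)).
  rewrite (_ : (fun _ => _) = (theta u K a * theta u K b) *: (fun s => f s 0 K)).
    by apply: is_derive_eq; rewrite [LHS]mulrC.
  by apply/funext => s /=; rewrite mulrC.
by rewrite derive_sum //; apply: eq_bigr => K _; rewrite derive_val.
Unshelve. all: by end_near. Qed.

Local Notation V := (slice c @^-1` U).

Lemma mean_curvature_frame u : V u ->
  mean_curvature g h c u = - (2 * kappa)^-1 * \sum_K f1 c 0 K / f c 0 K.
Proof.
move=> Vu; rewrite /mean_curvature.
under eq_bigr => a _ do under eq_bigr => b _ do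
  rewrite (christoffel_zrr openU kappa0 gE frame_metric_unit) //
          partial_transversal_frame_metric // mulrCA mulr_sumr.
under eq_bigr => a _ do rewrite -mulr_sumr exchange_big /=.
rewrite -mulr_sumr exchange_big /=; congr (_ * _); apply: eq_bigr => K _.
rewrite -(trace_frame K Vu) mulr_sumr; apply: eq_bigr => a _.
by rewrite mulr_sumr; apply: eq_bigr => b _; rewrite mulrCA.
Qed.

Lemma frame_tension u : V u -> tension g (slice c) u =
  (- (2 * kappa)^-1 * \sum_K f1 c 0 K / f c 0 K) *: delta_mx 0 z.
Proof.
move=> Vu; rewrite (tensionE openU kappa0 gE frame_metric_unit) //.
by rewrite mean_curvature_frame.
Qed.

(** This is the contribution of theta^K (x) theta^K to the contracted Koszul formula. Apart from the
    symmetrized derivative it consists of theta^K with a raised index, hence a multiple of e_K,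
    inserted into d theta^K; [theta_unimodular] makes that zero. *)
Lemma contracted_koszul u K l : V u ->
  \sum_a \sum_b invmx (h (slice c u)) a b *
    ((partial a (fun v => theta v K b) u * theta u K l +
      theta u K b * partial a (fun v => theta v K l) u) +
     (partial b (fun v => theta v K a) u * theta u K l +
      theta u K a * partial b (fun v => theta v K l) u) -
     (partial l (fun v => theta v K a) u * theta u K b +
      theta u K a * partial l (fun v => theta v K b) u)) =
  (\sum_a \sum_b invmx (h (slice c u)) a b *
    (partial a (fun v => theta v K b) u + partial b (fun v => theta v K a) u)) *
  theta u K l.
Proof.
move=> Vu; set D := fun a b => partial a (fun v => theta v K b) u.
set H := invmx _.
transitivity ((\sum_a \sum_b H a b * (D a b + D b a)) * theta u K l +
   \sum_a (\sum_b H a b * theta u K b) * (D a l - D l a) +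
   \sum_b (\sum_a H a b * theta u K a) * (D b l - D l b)).
  rewrite [X in _ = _ + _ + X](_ : _ = \sum_a \sum_b
    H a b * theta u K a * (D b l - D l b)); last first.
    by rewrite exchange_big; apply: eq_bigr => b _; rewrite mulr_suml.
  rewrite mulr_suml -!big_split /=; apply: eq_bigr => a _.
  rewrite !mulr_suml -!big_split /=; apply: eq_bigr => b _; rewrite /D; ring.
have E0 := theta_unimodular K l Vu.
have X0 : \sum_a invmx (theta u) a K / f c 0 K * (D a l - D l a) = 0.
  under eq_bigr do rewrite mulrAC.
  by rewrite -mulr_suml E0 mul0r.
under [X in _ + X + _]eq_bigr do rewrite inv_frame_metricl //.
under [X in _ + _ + X]eq_bigr do rewrite inv_frame_metricr //.
by rewrite X0 !addr0.
Qed.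

(** The inverse metric is taken at c and the Christoffel symbol at t, because only the latter is to
    be differentiated. By [contracted_koszul] the lowered symbol is a combination of the f_K(t)
    theta^K; raising its index at t turns f_K(t) theta^K into e_K, so that t disappears. *)
Lemma contracted_christoffel t u k : V u -> U (slice t u) ->
  \sum_a \sum_b invmx (h (slice c u)) a b *
    christoffel g (r k) (r a) (r b) (slice t u) =
  2^-1 * \sum_K invmx (theta u) k K *
   \sum_a \sum_b invmx (h (slice c u)) a b *
    (partial a (fun v => theta v K b) u + partial b (fun v => theta v K a) u).
Proof.
move=> Vu Ut.
under eq_bigr => a _ do under eq_bigr => b _ do
  rewrite (christoffel_rrr openU kappa0 gE frame_metric_unit) // mulrCA.
under eq_bigr => a _ do rewrite -mulr_sumr.
rewrite -mulr_sumr; congr (_ * _).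
transitivity (\sum_l invmx (h (slice t u)) k l * \sum_K f t 0 K *
  ((\sum_a \sum_b invmx (h (slice c u)) a b *
    (partial a (fun v => theta v K b) u + partial b (fun v => theta v K a) u)) *
   theta u K l)).
  transitivity (\sum_l \sum_K \sum_a \sum_b invmx (h (slice t u)) k l *
      (f t 0 K * (invmx (h (slice c u)) a b *
    ((partial a (fun v => theta v K b) u * theta u K l +
      theta u K b * partial a (fun v => theta v K l) u) +
     (partial b (fun v => theta v K a) u * theta u K l +
      theta u K a * partial b (fun v => theta v K l) u) -
     (partial l (fun v => theta v K a) u * theta u K b +
      theta u K a * partial l (fun v => theta v K b) u))))).
    rewrite -exchange_big2; apply: eq_bigr => a _; apply: eq_bigr => b _.
    rewrite mulr_sumr; apply: eq_bigr => l _.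
    rewrite -!mulr_sumr mulrCA; congr (_ * _).
    rewrite !partial_tangential_frame_metric // -big_split -sumrB mulr_sumr /=.
    by apply: eq_bigr => K _; rewrite -mulrDr -mulrBr mulrCA.
  apply: eq_bigr => l _; rewrite mulr_sumr; apply: eq_bigr => K _.
  rewrite -contracted_koszul // !mulr_sumr; apply: eq_bigr => a _.
  by rewrite !mulr_sumr.
under eq_bigr => l _ do rewrite mulr_sumr.
rewrite exchange_big /=; apply: eq_bigr => K _.
set S := (X in _ = _ * X).
transitivity (f t 0 K * S * \sum_l invmx (h (slice t u)) k l * theta u K l).
  rewrite mulr_sumr; apply: eq_bigr => l _; rewrite [LHS]mulrCA -[RHS]mulrA.
  by rewrite [in LHS](mulrCA _ S).
rewrite inv_frame_metricl //; have := f_neq0 K Ut; move: (f t 0 K) => fK fK0.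
by field.
Qed.

Lemma frame_bitension u : \sum_K f2 c 0 K / f c 0 K = 0 -> V u ->
  bitension g (slice c) u = 0.
Proof.
move=> f20 Vu; apply/rowP => k.
rewrite (bitensionE openU kappa0 gE frame_metric_sym frame_metric_unit eh ehV
  mean_curvature_frame) // mxE.
set H := invmx _; set X := \sum_a _; suff -> : X = 0 by rewrite mulr0.
have eG a b : elementary U (fun y => H a b * christoffel g k (r a) (r b) y).
  apply: elementaryM; first exact: elementary_cst.
  exact: (elementary_christoffel openU kappa0 gE frame_metric_unit).
(* The coefficients H are frozen at the slice, so the derivative can be moved outside the
   contraction. *)
have -> : X = partial z (fun y => \sum_a \sum_b H a b *
    christoffel g k (r a) (r b) y) (slice c u).
  rewrite (partial_sum openU) // => [|a]; last exact: elementary_sum.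
  apply: eq_bigr => a _; rewrite (partial_sum openU) //.
  apply: eq_bigr => b _; rewrite [RHS](partialM openU) //; last 2 first.
    exact: elementary_cst.
    exact: (elementary_christoffel openU kappa0 gE frame_metric_unit).
  by rewrite partial_cst mul0r add0r.
rewrite partial_transversal.
have [->|[d ->]] := I4P k; last first.
  (* Tangential component: the contraction is constant in t near c. *)
  rewrite -[RHS](derive_cst
    (2^-1 * \sum_K invmx (theta u) d K * \sum_a \sum_b H a b *
     (partial a (fun v => theta v K b) u + partial b (fun v => theta v K a) u))
    c 1).
  apply: near_eq_derive; near=> t; apply: contracted_christoffel => //.
  by near: t; exact: near_slice.
(* Normal component: the trace at c of theta^K (x) theta^K is 1 / f_K(c), so only the numerators
   f_K'(t) vary with t. *)
have -> : 'D_1 (fun t => \sum_a \sum_b H a b *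
      christoffel g z (r a) (r b) (slice t u)) c =
    'D_1 (\sum_K (fun t => - (2 * kappa)^-1 / f c 0 K * f1 t 0 K)) c.
  apply: near_eq_derive; near=> t.
  have Ut : U (slice t u) by near: t; exact: near_slice.
  rewrite fct_sumE.
  under eq_bigr => a _ do under eq_bigr => b _ do
    rewrite (christoffel_zrr openU kappa0 gE frame_metric_unit) //
            partial_transversal_frame_metric // mulrCA mulr_sumr.
  under eq_bigr => a _ do rewrite -mulr_sumr exchange_big /=.
  rewrite -mulr_sumr exchange_big mulr_sumr /=; apply: eq_bigr => K _.
  rewrite -mulrA; congr (_ * _).
  rewrite -(trace_frame K Vu) mulrC mulr_sumr; apply: eq_bigr => a _.
  by rewrite mulr_sumr; apply: eq_bigr => b _; rewrite mulrCA.
have dK K : is_derive c 1 (fun t => - (2 * kappa)^-1 / f c 0 K * f1 t 0 K)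
    (- (2 * kappa)^-1 / f c 0 K * f2 c 0 K).
  rewrite (_ : (fun _ => _) = (- (2 * kappa)^-1 / f c 0 K) *: (fun s => f1 s 0 K)).
    exact: is_derive_eq.
  by [].
rewrite derive_sum //; under eq_bigr do rewrite derive_val -mulrA (mulrC _^-1).
by rewrite -mulr_sumr f20 mulr0.
Unshelve. all: by end_near. Qed.

End FrameMetric.

Lemma I2P (i : 'I_2) : i = 0 \/ i = 1.
Proof. by case: i => [[|[|//]] hi]; [left|right]; apply/val_inj. Qed.

Lemma I3P (i : 'I_3) : [\/ i = 0, i = 1 | i = 2%:R].
Proof.
by case: i => [[|[|[|//]]] hi]; [apply: Or31|apply: Or32|apply: Or33];
  apply/val_inj.
Qed.

Lemma sum_I2 (V : zmodType) (F : 'I_2 -> V) : \sum_i F i = F 0 + F 1.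
Proof. by rewrite !big_ord_recl big_ord0 addr0; congr (F _ + F _); apply/val_inj. Qed.

Lemma sum_I3 (V : zmodType) (F : 'I_3 -> V) : \sum_i F i = F 0 + F 1 + F 2%:R.
Proof.
by rewrite !big_ord_recl big_ord0 addr0 addrA; congr (F _ + F _ + F _);
  apply/val_inj.
Qed.

(** * SU(2) as unit quaternions, and its action by rotations *)

Section Rotations.
Variable R : realType.
Local Notation C := R[i].

Definition mx3 (s : seq (seq R)) : 'M[R]_3 := \matrix_(i, j) (nth [::] s i)`_j.

Definition quaternion (x y w v : R) : 'M[C]_2 :=
  \matrix_(i, j) (nth [::] [:: [:: x +i* y; w +i* v]; [:: - w +i* v; x -i* y]] i)`_j.

(** The quadratic quaternion formula, arranged to multiply row vectors from the right. *)
Definition rotation_mx (x y w v : R) : 'M[R]_3 := mx3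
  [:: [:: x ^+ 2 - y ^+ 2 - w ^+ 2 + v ^+ 2; 2 * (w * v - x * y); 2 * (x * w + y * v)];
      [:: 2 * (x * y + w * v); x ^+ 2 - y ^+ 2 + w ^+ 2 - v ^+ 2; 2 * (y * w - x * v)];
      [:: 2 * (y * v - x * w); 2 * (x * v + y * w); x ^+ 2 + y ^+ 2 - w ^+ 2 - v ^+ 2]].

Lemma su2_act_quaternion x y w v p :
  su2_act (quaternion x y w v) p = p *m rotation_mx x y w v.
Proof.
apply/matrixP => i j; rewrite !mxE sum_I3 !mxE.
case: (I3P j) => -> /=; rewrite !(mxE, sum_I2) /=; by field.
Qed.

Lemma rotation_mx_orthogonal x y w v : x ^+ 2 + y ^+ 2 + w ^+ 2 + v ^+ 2 = 1 ->
  rotation_mx x y w v *m (rotation_mx x y w v)^T = 1%:M.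
Proof.
move=> n1.
(* The entries of the product have degree 4, and they equal the squared norm times those of the
   identity as polynomials. *)
have -> : 1%:M = ((x ^+ 2 + y ^+ 2 + w ^+ 2 + v ^+ 2) ^+ 2)%:M :> 'M[R]_3.
  by rewrite n1 expr1n.
apply/matrixP => i j; rewrite !mxE sum_I3 !mxE.
by case: (I3P i) => ->; case: (I3P j) => -> /=; ring.
Qed.

Lemma SU2_quaternion x y w v : x ^+ 2 + y ^+ 2 + w ^+ 2 + v ^+ 2 = 1 ->
  SU2 (quaternion x y w v).
Proof.
move=> n1; split; last first.
  rewrite (expand_det_row _ 0) sum_I2 /cofactor !det_mx11 !mxE /=.
  apply/eqP; rewrite eq_complex /=.
  by apply/andP; split; apply/eqP; first [ring | rewrite -[RHS]n1; ring].
apply/matrixP => i j; rewrite !mxE sum_I2 !mxE.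
case: (I2P i) => ->; case: (I2P j) => -> /=; apply/eqP; rewrite eq_complex /=;
  by apply/andP; split; apply/eqP; first [ring | rewrite -[RHS]n1; ring].
Qed.

(** Unitarity and determinant 1 identify the conjugate transpose with the adjugate, which expresses
    the second row through the first. *)
Lemma SU2P a : SU2 a -> exists x y w v : R,
  x ^+ 2 + y ^+ 2 + w ^+ 2 + v ^+ 2 = 1 /\ a = quaternion x y w v.
Proof.
case=> aa1 deta.
have aE : a ^t* = \adj a.
  have /(congr1 (mulmx^~ (\adj a))) : a ^t* *m a = 1%:M by exact: mulmx1C.
  by rewrite mul1mx -mulmxA mul_mx_adj deta mulmx1.
have adjE : \adj a = \matrix_(i, j)
    (nth [::] [:: [:: a 1 1; - a 0 1]; [:: - a 1 0; a 0 0]] i)`_j.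
  apply/matrixP => i j; rewrite !mxE /cofactor det_mx11 !mxE.
  by case: (I2P i) => ->; case: (I2P j) => -> /=;
    rewrite ?(@modn_small 1 2) // exprD ?expr0 ?expr1 ?mulrNN ?mulr1 ?mul1r
      ?mulN1r; first [congr (- (a _ _))|congr (a _ _)];
    apply/val_inj.
have e00 := congr1 (fun M : 'M[C]_2 => M 0 0) aE.
have e10 := congr1 (fun M : 'M[C]_2 => M 1 0) aE.
rewrite adjE !mxE /= in e00 e10.
have n1 := congr1 (fun M : 'M[C]_2 => M 0 0) aa1.
rewrite !mxE sum_I2 !mxE /= in n1.
case E00 : (a 0 0) e00 n1 => [x y] /= e00; case E01 : (a 0 1) e10 => [w v] /= e10.
move=> [n1 _]; exists x, y, w, v; split; first by rewrite -[RHS]n1; ring.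
apply/matrixP => i j; rewrite !mxE.
case: (I2P i) => ->; case: (I2P j) => -> //=.
by apply: oppr_inj; rewrite -e10; apply/eqP; rewrite eq_complex /= opprK !eqxx.
Qed.

Lemma SU2M a b : @SU2 R a -> SU2 b -> SU2 (a *m b).
Proof.
move=> [aa1 deta] [bb1 detb]; split; last by rewrite det_mulmx deta detb mulr1.
by rewrite trmx_mul map_mxM mulmxA -(mulmxA a) bb1 mulmx1.
Qed.

(** Nothing is lost between the two rotations: the conjugate of [projector q] by b is still
    Hermitian of trace 1, so [projector_bloch] recovers it. *)
Lemma rotateM a b q : @SU2 R b -> rotate (a *m b) q = rotate a (rotate b q).
Proof.
move=> [bb1 _]; have {bb1} bb1 : b ^t* *m b = 1%:M by apply: mulmx1C.
have hP : (projector q) ^t* = projector q.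
  apply/matrixP => i j; rewrite !mxE.
  by case: (I2P i) => ->; case: (I2P j) => -> /=; apply/eqP;
    rewrite eq_complex /= ?oppr0 ?opprK !eqxx.
have trP : \tr (projector q) = 1.
  rewrite /mxtrace sum_I2 !mxE /=; apply/eqP; rewrite eq_complex /= addr0 eqxx.
  by rewrite andbT; apply/eqP; field.
rewrite /rotate projector_bloch.
- by rewrite trmx_mul map_mxM !mulmxA.
- by rewrite !trmx_mul !map_mxM trmxCK hP mulmxA.
- by rewrite mxtrace_mulC mulmxA bb1 mul1mx.
Qed.

Lemma su2_actM a b p : @SU2 R b -> su2_act (a *m b) p = su2_act a (su2_act b p).
Proof.
by move=> Sb; apply/row_matrixP => i; rewrite !rowK rotateM.
Qed.

Definition orthogonal_mx (O : 'M[R]_3) : Prop := O *m O^T = 1%:M.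

Lemma su2_act_orthogonal a : SU2 a ->
  exists2 O, orthogonal_mx O & forall p, su2_act a p = p *m O.
Proof.
move=> /SU2P[x [y [w [v [n1 ->]]]]]; exists (rotation_mx x y w v).
  exact: rotation_mx_orthogonal.
exact: su2_act_quaternion.
Qed.

(** For a row p, [p *m skew o] is the cross product of p with o. *)
Definition skew (o : 'rV[R]_3) : 'M[R]_3 := mx3
  [:: [:: 0; - o 0 2%:R; o 0 1]; [:: o 0 2%:R; 0; - o 0 0]; [:: - o 0 1; o 0 0; 0]].

(** The halves compensate the doubling of angles from SU(2) to SO(3): o is the angular velocity of
    the action field, and Q becomes twice the dot product. *)
Definition su2_of (o : 'rV[R]_3) : 'M[C]_2 := \matrix_(i, j)
  (nth [::] [:: [:: 0 +i* (o 0 2%:R / 2); (o 0 1 / 2) +i* (o 0 0 / 2)];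
                [:: (- (o 0 1) / 2) +i* (o 0 0 / 2); 0 +i* (- (o 0 2%:R) / 2)]] i)`_j.

Lemma su2_su2_of o : su2 (su2_of o).
Proof.
split.
  apply/matrixP => i j; rewrite !mxE.
  by case: (I2P i) => ->; case: (I2P j) => -> /=; apply/eqP;
    rewrite eq_complex /=; apply/andP; split; apply/eqP; ring.
by rewrite /mxtrace sum_I2 !mxE /=; apply/eqP; rewrite eq_complex /=;
   apply/andP; split; apply/eqP; ring.
Qed.

Lemma su2P X : su2 X -> exists o, X = su2_of o.
Proof.
move=> [hX trX].
have e00 := congr1 (fun M : 'M[C]_2 => M 0 0) hX.
have e10 := congr1 (fun M : 'M[C]_2 => M 1 0) hX.
rewrite /mxtrace sum_I2 in trX; rewrite !mxE in e00 e10.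
case E00 : (X 0 0) e00 trX => [x y]; case E01 : (X 0 1) e10 => [w v].
case E11 : (X 1 1) => [x' y']; case E10 : (X 1 0) => [w' v'] /=.
move=> [e1 e2] [e3] [e4 e5].
exists (\row_j [:: v * 2; w * 2; y * 2]`_j); apply/matrixP => i j; rewrite !mxE /=.
by case: (I2P i) => ->; case: (I2P j) => -> /=; rewrite ?E00 ?E01 ?E10 ?E11;
  apply/eqP; rewrite eq_complex /=; apply/andP; split; apply/eqP; lra.
Qed.

Lemma action_field_su2_of o p : action_field (su2_of o) p = p *m skew o.
Proof.
apply/matrixP => i j; rewrite !mxE sum_I3 !mxE.
by case: (I3P j) => -> /=; rewrite !(mxE, sum_I2) /=; field.
Qed.

Lemma Q_su2_of o o' : Q (su2_of o) (su2_of o') = - \tr (skew o *m skew o').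
Proof.
by rewrite /Q /mxtrace sum_I2 sum_I3 !(mxE, sum_I2, sum_I3) /=; field.
Qed.

Lemma skew_tr o : (skew o)^T = - skew o.
Proof.
apply/matrixP => i j; rewrite !mxE.
by case: (I3P i) => ->; case: (I3P j) => -> /=; ring.
Qed.

Lemma skewP K : K^T = - K -> exists o, K = skew o.
Proof.
move=> hK; have e i j : K j i = - K i j.
  by have /matrixP/(_ i j) := hK; rewrite !mxE.
exists (\row_j [:: K 2%:R 1; K 0 2%:R; K 1 0]`_j); apply/matrixP => i j.
have := e 0 0; have := e 1 1; have := e 2%:R 2%:R.
have := e 0 1; have := e 0 2%:R; have := e 1 2%:R.
by rewrite !mxE; case: (I3P i) => ->; case: (I3P j) => -> /=; lra.
Qed.

End Rotations.

(** * The metric g_1 from the submersion, along the normal geodesic *)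

Section MetricOnOrbits.
Variable R : realType.
Local Notation space := (Defs.space R).

Lemma product_metricE (p u v : space) : product_metric p u v = \tr (u *m v^T).
Proof.
by apply: eq_bigr => i _; rewrite mxE; apply: eq_bigr => j _; rewrite mxE.
Qed.

Lemma S2xS2E (p : space) : S2xS2 p <-> forall i, (p *m p^T) i i = 1.
Proof.
by split=> h i; rewrite -(h i) mxE; apply: eq_bigr => j _; rewrite mxE expr2.
Qed.

Lemma tangentE (p v : space) : tangent p v <-> forall i, (p *m v^T) i i = 0.
Proof.
suff e i : (p *m v^T) i i = \sum_j p i j * v i j.
  by split=> h i; have := h i; rewrite e.
by rewrite mxE; apply: eq_bigr => j _; rewrite mxE.
Qed.

Lemma su2_act1 (p : space) : su2_act 1%:M p = p.
Proof.
have -> : 1%:M = quaternion 1 0 0 0 :> 'M[R[i]]_2.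
  apply/matrixP => i j; rewrite !mxE.
  by case: (I2P i) => ->; case: (I2P j) => -> /=; apply/eqP;
    rewrite eq_complex /= ?oppr0 !eqxx.
rewrite su2_act_quaternion (_ : rotation_mx 1 0 0 0 = 1%:M) ?mulmx1 //.
apply/matrixP => i j; rewrite !mxE.
by case: (I3P i) => ->; case: (I3P j) => -> /=; ring.
Qed.

(* For s = 1, the su(2) component, as a skew matrix, of the horizontal vector of
   [S2xS2 * SU2] at [(p, 1)] whose first component is w. *)
Definition momentum (p w : space) : 'M[R]_3 := 2^-1 *: (w^T *m p - p^T *m w).

Lemma momentum_skew p w : (momentum p w)^T = - momentum p w.
Proof. by rewrite /momentum linearZ linearB /= !trmx_mul !trmxK -scalerN opprB. Qed.

(** The submersion property is applied at the identity of the group. The momentum is the adjoint of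
    the infinitesimal action, so pairing w with it gives a horizontal vector, whose image under the
    differential is w minus the action field of the momentum. *)
Lemma cheeger_metricE (g : R -> metric R) p w w' : cheeger_deformation g ->
  S2xS2 p -> tangent p w -> tangent p w' ->
  g 1 p (w - p *m momentum p w) (w' - p *m momentum p w') =
  \tr (w *m w'^T) - \tr (momentum p w *m momentum p w').
Proof.
move=> [_ /(_ 1 ltr01)[_ sub]] Sp Tw Tw'.
have SU1 : SU2 (1%:M : 'M[R[i]]_2).
  by split; [rewrite trmx1 map_mx1 mulmx1|exact: det1].
have hor v : tangent p v -> exists o, momentum p v = skew o /\
    horizontal 1 p 1%:M v (su2_of o).
  move=> Tv; have [k hk] := skewP (momentum_skew p v); exists k.
  split=> //; split=> // [|v' X' Tv' /su2P[k' ->]]; first exact: su2_su2_of.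
  rewrite /drho /rho invmx1 !su2_act1 action_field_su2_of => /subr0_eq ->.
  rewrite /lift_metric product_metricE Q_su2_of invr1 mul1r -hk.
  (* Only the antisymmetric part of [v^T *m p] pairs with a skew matrix, which is why the momentum
     is that part. *)
  have e : \tr (v^T *m p *m skew k') = - \tr (p^T *m v *m skew k').
    by rewrite -mxtrace_tr !trmx_mul trmxK skew_tr mulNmx linearN /= mxtrace_mulC.
  rewrite trmx_mul skew_tr mulNmx mulmxN linearN /= mulmxA mxtrace_mulC mulmxA.
  rewrite /momentum -scalemxAl linearZ mulmxBl linearB /= e; lra.
have [k [hk Hk]] := hor _ Tw; have [k' [hk' Hk']] := hor _ Tw'.
have := sub p 1%:M Sp SU1 _ _ _ _ Hk Hk'.
rewrite /drho /rho invmx1 !su2_act1 !action_field_su2_of -hk -hk' => ->.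
by rewrite /lift_metric product_metricE Q_su2_of invr1 mul1r -hk -hk'.
Qed.

Lemma S2xS2_orthogonal (p : space) O : orthogonal_mx O -> S2xS2 p -> S2xS2 (p *m O).
Proof.
move=> OO /S2xS2E Sp; apply/S2xS2E => i.
by rewrite trmx_mul mulmxA -(mulmxA p) OO mulmx1.
Qed.

Lemma tangent_orthogonal (p v : space) O : orthogonal_mx O -> tangent p v ->
  tangent (p *m O) (v *m O).
Proof.
move=> OO /tangentE Tv; apply/tangentE => i.
by rewrite trmx_mul mulmxA -(mulmxA p) OO mulmx1.
Qed.

(** Since the momentum is equivariant under right multiplication by O, [cheeger_metricE] at [p *m O]
    yields the same traces as at p. *)
Lemma cheeger_metric_orthogonal (g : R -> metric R) (p w w' : space) O :
  cheeger_deformation g -> orthogonal_mx O ->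
  S2xS2 p -> tangent p w -> tangent p w' ->
  g 1 (p *m O) ((w - p *m momentum p w) *m O) ((w' - p *m momentum p w') *m O) =
  \tr (w *m w'^T) - \tr (momentum p w *m momentum p w').
Proof.
move=> hg OO Sp Tw Tw'.
have mO v : momentum (p *m O) (v *m O) = O^T *m momentum p v *m O.
  rewrite /momentum !trmx_mul -scalemxAr -scalemxAl; congr (_ *: _).
  by rewrite mulmxBr mulmxBl !mulmxA.
have E v : (v - p *m momentum p v) *m O =
    v *m O - p *m O *m momentum (p *m O) (v *m O).
  by rewrite mO mulmxBl !mulmxA -(mulmxA p) OO mulmx1.
rewrite !E cheeger_metricE //; try exact: tangent_orthogonal.
- rewrite !mO; congr (_ - _).
    by rewrite trmx_mul mulmxA -(mulmxA w O) OO mulmx1.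
  rewrite !mulmxA -(mulmxA _ O (O^T)) OO mulmx1 mxtrace_mulC !mulmxA OO.
  by rewrite mul1mx.
- exact: S2xS2_orthogonal.
Qed.

Definition gam (t : R) : space := \matrix_(i, j)
  [:: (-1) ^+ i * sin (2 * t); 0; cos (2 * t)]`_j.

Lemma normal_geodesicE t : normal_geodesic t = gam t.
Proof.
apply/row_matrixP => i; rewrite rowK /of_line.
set v := \col_k _.
have vE k l : (v *m v ^t*) k l =
    ([:: cos t; (-1) ^+ i * sin t]`_k * [:: cos t; (-1) ^+ i * sin t]`_l)%:C.
  rewrite !mxE big_ord1 !mxE.
  case: (I2P k) => ->; case: (I2P l) => -> /=; apply/eqP; rewrite eq_complex /=;
  by apply/andP; split; apply/eqP; ring.
have -> : \tr (v *m v ^t*) = 1.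
  rewrite /mxtrace sum_I2 !vE /=; apply/eqP; rewrite eq_complex /=.
  apply/andP; split; apply/eqP; last by ring.
  by rewrite -[RHS](cos2Dsin2 t); case: (I2P i) => -> /=; ring.
rewrite invr1 scale1r; apply/rowP => k; rewrite [LHS]mxE [RHS]mxE [RHS]mxE.
have -> : 2 * t = t + t by ring.
rewrite sinD cosD.
case: (I3P k) => -> /=; rewrite !vE /=; have [e|e] := I2P i; rewrite ?e /=; ring.
Qed.

Definition dgam (t : R) : space := \matrix_(i, j)
  [:: (-1) ^+ i * (2 * cos (2 * t)); 0; - (2 * sin (2 * t))]`_j.

(** The eigenvalues of P_t, listed for rotations about the first, second and third axis of R^3. *)
Definition orbit_coef (t : R) : 'rV[R]_3 :=
  \row_j [:: cos (2 * t) ^+ 2; 1; sin (2 * t) ^+ 2]`_j.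

Lemma S2xS2_gam t : S2xS2 (gam t).
Proof.
move=> i; rewrite sum_I3 !mxE /= exprMn sqrr_sign mul1r expr0n addr0.
by rewrite addrC cos2Dsin2.
Qed.

Lemma orbit_coef_ge0 t K : 0 <= orbit_coef t 0 K.
Proof. by rewrite mxE; case: (I3P K) => -> /=; rewrite ?sqr_ge0. Qed.

Lemma tangent_gam_skew t o : tangent (gam t) (gam t *m skew o).
Proof.
by move=> i; rewrite sum_I3 !mxE !sum_I3 !mxE /=; ring.
Qed.

Lemma tangent_dgam t : tangent (gam t) (dgam t).
Proof.
move=> i; rewrite sum_I3 !mxE /=; case: (I2P i) => -> /=; rewrite ?expr0 ?expr1; ring.
Qed.

Lemma momentum_dgam t : momentum (gam t) (dgam t) = 0.
Proof.
apply/matrixP => i j; rewrite !(mxE, sum_I2).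
by case: (I3P i) => ->; case: (I3P j) => -> /=; rewrite ?expr0 ?expr1; ring.
Qed.

Lemma momentum_gam_skew t o : momentum (gam t) (gam t *m skew o) =
  - skew (\row_K (orbit_coef t 0 K * o 0 K)).
Proof.
(* The middle entry 1 is written as cos^2 + sin^2, so that the identity holds for polynomials in the
   sine and the cosine. *)
have -> : orbit_coef t = \row_j [:: cos (2 * t) ^+ 2;
    cos (2 * t) ^+ 2 + sin (2 * t) ^+ 2; sin (2 * t) ^+ 2]`_j.
  by rewrite cos2Dsin2.
apply/matrixP => i j; rewrite !(mxE, sum_I2, sum_I3).
by case: (I3P i) => ->; case: (I3P j) => -> /=; rewrite ?(@modn_small 1 2) ?expr0 ?expr1 //; field.
Qed.

End MetricOnOrbits.

Section CheegerMetricOnFrame.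
Variable R : realType.

Lemma skewD o o' : skew (o + o') = skew o + skew o' :> 'M[R]_3.
Proof.
apply/matrixP => i j; rewrite !mxE.
by case: (I3P i) => ->; case: (I3P j) => -> /=; ring.
Qed.

(** The Cheeger formula P / (1 + P), doubled because a unit angular velocity has squared Q-length
    2. *)
Definition orbit_metric (t : R) : 'rV[R]_3 :=
  \row_K (2 * orbit_coef t 0 K / (1 + orbit_coef t 0 K)).

Lemma orbit_coef1_neq0 (t : R) K : 1 + orbit_coef t 0 K != 0.
Proof. by rewrite gt_eqF // ltr_wpDr // orbit_coef_ge0. Qed.

Variables (g : R -> metric R) (hg : cheeger_deformation g).

(** Subtracting the momentum multiplies the K-th angular velocity by 1 + P_K; dividing by it gives
    the horizontal vector that projects onto the action field of o. *)
Let horizontal_skew (t : R) (o : 'rV[R]_3) : 'rV[R]_3 :=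
  \row_K (o 0 K / (1 + orbit_coef t 0 K)).

Let gam_skewE t o : gam t *m skew o =
  gam t *m skew (horizontal_skew t o) -
  gam t *m momentum (gam t) (gam t *m skew (horizontal_skew t o)).
Proof.
rewrite momentum_gam_skew mulmxN opprK -mulmxDr -skewD; congr (_ *m skew _).
rewrite /horizontal_skew; apply/rowP => K; have := orbit_coef1_neq0 t K.
by move: (orbit_coef t) => P P0; rewrite !mxE; field.
Qed.

(** The velocity has zero momentum, so the deformation leaves its length alone. Each of the two
    spheres contributes 4. *)
Lemma cheeger_dgam_dgam t O : orthogonal_mx O ->
  g 1 (gam t *m O) (dgam t *m O) (dgam t *m O) = 8.
Proof.
move=> OO; rewrite -{1 2}(subr0 (dgam t)) -{1 2}(mulmx0 _ (gam t)).
rewrite -(momentum_dgam t) (cheeger_metric_orthogonal hg) //; first last.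
- exact: tangent_dgam.
- exact: tangent_dgam.
- exact: S2xS2_gam.
rewrite momentum_dgam mulmx0 mxtrace0 subr0.
transitivity (8 * (cos (2 * t) ^+ 2 + sin (2 * t) ^+ 2)); last first.
  by rewrite cos2Dsin2 mulr1.
by rewrite /mxtrace !(mxE, sum_I2, sum_I3) /= ?(@modn_small 1 2) // expr0 expr1; ring.
Qed.

Lemma cheeger_dgam_skew t O o : orthogonal_mx O ->
  g 1 (gam t *m O) (dgam t *m O) (gam t *m skew o *m O) = 0 /\
  g 1 (gam t *m O) (gam t *m skew o *m O) (dgam t *m O) = 0.
Proof.
move=> OO.
have dgamE : dgam t = dgam t - gam t *m momentum (gam t) (dgam t).
  by rewrite momentum_dgam mulmx0 subr0.
rewrite gam_skewE dgamE !(cheeger_metric_orthogonal hg) //;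
  try exact: tangent_dgam; try exact: tangent_gam_skew; try exact: S2xS2_gam.
rewrite momentum_dgam mulmx0 mul0mx mxtrace0 !subr0.
move: (horizontal_skew t o) => w.
by split; rewrite /mxtrace !(mxE, sum_I2, sum_I3) /= ?(@modn_small 1 2) //
  expr0 expr1; ring.
Qed.

Lemma cheeger_skew_skew t O o o' : orthogonal_mx O ->
  g 1 (gam t *m O) (gam t *m skew o *m O) (gam t *m skew o' *m O) =
  \sum_K orbit_metric t 0 K * o 0 K * o' 0 K.
Proof.
move=> OO; rewrite (gam_skewE t o) (gam_skewE t o') (cheeger_metric_orthogonal hg) //;
  try exact: tangent_gam_skew; try exact: S2xS2_gam.
rewrite !momentum_gam_skew mulmxN mulNmx opprK.
transitivity (\sum_K 2 * orbit_coef t 0 K * (1 + orbit_coef t 0 K) *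
   horizontal_skew t o 0 K * horizontal_skew t o' 0 K); last first.
  apply: eq_bigr => K _; have := orbit_coef1_neq0 t K.
  rewrite /orbit_metric /horizontal_skew; move: (orbit_coef t) => P P0.
  by rewrite !mxE; field.
move: (horizontal_skew t o) (horizontal_skew t o') => w w'.
have -> : orbit_coef t = \row_j [:: cos (2 * t) ^+ 2;
    cos (2 * t) ^+ 2 + sin (2 * t) ^+ 2; sin (2 * t) ^+ 2]`_j.
  by rewrite cos2Dsin2.
rewrite /mxtrace !(mxE, sum_I2, sum_I3) /= ?(@modn_small 1 2) // expr0 expr1.
by ring.
Qed.

End CheegerMetricOnFrame.

(** * Euler-angle parametrizations of the orbits *)

Section FrameMap.
Variable R : realType.

Definition rotx (t : R) := mx3
  [:: [:: 1; 0; 0]; [:: 0; cos t; - sin t]; [:: 0; sin t; cos t]].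
Definition roty (t : R) := mx3
  [:: [:: cos t; 0; sin t]; [:: 0; 1; 0]; [:: - sin t; 0; cos t]].
Definition rotz (t : R) := mx3
  [:: [:: cos t; - sin t; 0]; [:: sin t; cos t; 0]; [:: 0; 0; 1]].

Lemma half_angle (t : R) : cos t = cos (t / 2) ^+ 2 - sin (t / 2) ^+ 2 /\
  sin t = 2 * (sin (t / 2) * cos (t / 2)).
Proof. by rewrite {1 4}[t]splitr cosD sinD; split; ring. Qed.

Lemma rotx_quaternion t : rotx t = rotation_mx (cos (t / 2)) 0 0 (sin (t / 2)).
Proof.
have [ec es] := half_angle t; have e1 := cos2Dsin2 (t / 2).
apply/matrixP => i j; rewrite !mxE ec es.
by case: (I3P i) => ->; case: (I3P j) => -> /=; rewrite -?[LHS]e1; lra.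
Qed.

Lemma roty_quaternion t : roty t = rotation_mx (cos (t / 2)) 0 (sin (t / 2)) 0.
Proof.
have [ec es] := half_angle t; have e1 := cos2Dsin2 (t / 2).
apply/matrixP => i j; rewrite !mxE ec es.
by case: (I3P i) => ->; case: (I3P j) => -> /=; rewrite -?[LHS]e1; lra.
Qed.

Lemma rotz_quaternion t : rotz t = rotation_mx (cos (t / 2)) (sin (t / 2)) 0 0.
Proof.
have [ec es] := half_angle t; have e1 := cos2Dsin2 (t / 2).
apply/matrixP => i j; rewrite !mxE ec es.
by case: (I3P i) => ->; case: (I3P j) => -> /=; rewrite -?[LHS]e1; lra.
Qed.

Definition euler (u : 'rV[R]_3) : 'M[R]_3 :=
  rotz (u 0 2%:R) *m roty (u 0 1) *m rotx (u 0 0).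

Lemma euler_su2_act u : exists2 b, SU2 b & forall p, su2_act b p = p *m euler u.
Proof.
have n1 (t : R) := cos2Dsin2 t.
(* The action is from the left on points but the rotation matrices multiply rows from the right, so
   the factors occur in the opposite order to [euler]. *)
exists (quaternion (cos (u 0 0 / 2)) 0 0 (sin (u 0 0 / 2)) *m
  (quaternion (cos (u 0 1 / 2)) 0 (sin (u 0 1 / 2)) 0 *m
   quaternion (cos (u 0 2%:R / 2)) (sin (u 0 2%:R / 2)) 0 0)).
  by do ![apply: SU2M]; apply: SU2_quaternion; rewrite !expr0n /= ?addr0.
move=> p; rewrite !su2_actM; last 2 first.
- by apply: SU2_quaternion; rewrite !expr0n /= ?addr0.
- by apply: SU2M; apply: SU2_quaternion; rewrite !expr0n /= ?addr0.
by rewrite !su2_act_quaternion -rotx_quaternion -roty_quaternion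
  -rotz_quaternion /euler !mulmxA.
Qed.

Lemma orthogonalM (A B : 'M[R]_3) :
  orthogonal_mx A -> orthogonal_mx B -> orthogonal_mx (A *m B).
Proof.
move=> AA BB; rewrite /orthogonal_mx trmx_mul mulmxA -(mulmxA A B) BB mulmx1.
exact: AA.
Qed.

Lemma rotx_orthogonal t : orthogonal_mx (rotx t).
Proof.
rewrite rotx_quaternion; apply: rotation_mx_orthogonal.
by rewrite !expr0n /= !addr0 cos2Dsin2.
Qed.
Lemma roty_orthogonal t : orthogonal_mx (roty t).
Proof.
rewrite roty_quaternion; apply: rotation_mx_orthogonal.
by rewrite !expr0n /= !addr0 cos2Dsin2.
Qed.
Lemma rotz_orthogonal t : orthogonal_mx (rotz t).
Proof.
rewrite rotz_quaternion; apply: rotation_mx_orthogonal.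
by rewrite !expr0n /= !addr0 cos2Dsin2.
Qed.

Lemma euler_orthogonal u : orthogonal_mx (euler u).
Proof.
apply: orthogonalM; last exact: rotx_orthogonal.
by apply: orthogonalM; [exact: rotz_orthogonal|exact: roty_orthogonal].
Qed.

(* Column a holds the angular velocity, in the rotating frame, of the a-th
   partial derivative of [euler]. *)
Definition euler_velocity (u : 'rV[R]_3) : 'M[R]_3 := mx3
  [:: [:: cos (u 0 1) * cos (u 0 2%:R); - sin (u 0 2%:R); 0];
      [:: cos (u 0 1) * sin (u 0 2%:R); cos (u 0 2%:R); 0];
      [:: - sin (u 0 1); 0; 1]].

Definition tangential_part (x : 'rV[R]_4) : 'rV[R]_3 := \row_a x 0 (tangential a).

(** The factor O moves the chart to an arbitrary point of an orbit. The rotation by Euler angles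
    stands next to [gam], so derivatives produce left-invariant forms and the metric coefficients do
    not involve O. *)
Definition frame_map (O : 'M[R]_3) (x : 'rV[R]_4) : Defs.space R :=
  gam (x 0 transversal) *m (euler (tangential_part x) *m O).

Local Notation z := transversal.
Local Notation r := tangential.

End FrameMap.

Ltac solve_elementary := repeat first
  [ exact: elementary_cst | exact: elementary_coord | apply: elementaryN
  | apply: elementaryD | apply: elementaryM | apply: elementary_sin
  | apply: elementary_cos ].

(** * Derivatives of the parametrizations *)

Section FrameMapDerivatives.
Variable R : realType.

Lemma partial_sin_coord n (i j : 'I_n) (x : 'rV[R]_n) :
  partial i (fun y => sin (y 0 j)) x = cos (x 0 j) * (i == j)%:R.
Proof.
rewrite (partial_sin openT) ?partial_coord //; exact: elementary_coord.
Qed.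

Lemma partial_cos_coord n (i j : 'I_n) (x : 'rV[R]_n) :
  partial i (fun y => cos (y 0 j)) x = - sin (x 0 j) * (i == j)%:R.
Proof.
rewrite (partial_cos openT) ?partial_coord //; exact: elementary_coord.
Qed.

Lemma partialN_setT n (i : 'I_n) (x : 'rV[R]_n) f : elementary setT f ->
  partial i (fun y => - f y) x = - partial i f x.
Proof. exact: (partialN openT). Qed.

Lemma partialM_setT n (i : 'I_n) (x : 'rV[R]_n) f h :
  elementary setT f -> elementary setT h ->
  partial i (fun y => f y * h y) x = partial i f x * h x + f x * partial i h x.
Proof. exact: (partialM openT). Qed.

Lemma elementary_mx3 n (U : set 'rV[R]_n) (s : 'rV[R]_n -> seq (seq R)) :
  (forall i j : 'I_3, elementary U (fun x => (nth [::] (s x) i)`_j)) ->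
  elementary_mx U (fun x => mx3 (s x)).
Proof. by move=> es i j; apply: (elementary_eq _ (es i j)) => x _; rewrite mxE. Qed.

Section Rotation.
Variables (n : nat) (i j : 'I_n) (x : 'rV[R]_n).

Lemma elementary_rotx : elementary_mx setT (fun y : 'rV[R]_n => rotx (y 0 j)).
Proof.
apply: elementary_mx3 => k l.
by case: (I3P k) => ->; case: (I3P l) => -> /=; solve_elementary.
Qed.
Lemma elementary_roty : elementary_mx setT (fun y : 'rV[R]_n => roty (y 0 j)).
Proof.
apply: elementary_mx3 => k l.
by case: (I3P k) => ->; case: (I3P l) => -> /=; solve_elementary.
Qed.
Lemma elementary_rotz : elementary_mx setT (fun y : 'rV[R]_n => rotz (y 0 j)).
Proof.
apply: elementary_mx3 => k l.
by case: (I3P k) => ->; case: (I3P l) => -> /=; solve_elementary.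
Qed.

Lemma partial_rotx : partial i (fun y => rotx (y 0 j)) x =
  (i == j)%:R *: (skew (delta_mx 0 0) *m rotx (x 0 j)).
Proof.
rewrite (partial_mxE openT) //; last exact: elementary_rotx.
apply/matrixP => k l; rewrite !(mxE, sum_I3).
under eq_fun do rewrite mxE.
case: (I3P k) => ->; case: (I3P l) => -> /=;
  rewrite ?partial_cst ?partialN_setT ?partial_sin_coord ?partial_cos_coord /=;
  solve_elementary; ring.
Qed.
Lemma partial_roty : partial i (fun y => roty (y 0 j)) x =
  (i == j)%:R *: (skew (delta_mx 0 1) *m roty (x 0 j)).
Proof.
rewrite (partial_mxE openT) //; last exact: elementary_roty.
apply/matrixP => k l; rewrite !(mxE, sum_I3).
under eq_fun do rewrite mxE.
case: (I3P k) => ->; case: (I3P l) => -> /=;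
  rewrite ?partial_cst ?partialN_setT ?partial_sin_coord ?partial_cos_coord /=;
  solve_elementary; ring.
Qed.
Lemma partial_rotz : partial i (fun y => rotz (y 0 j)) x =
  (i == j)%:R *: (skew (delta_mx 0 2%:R) *m rotz (x 0 j)).
Proof.
rewrite (partial_mxE openT) //; last exact: elementary_rotz.
apply/matrixP => k l; rewrite !(mxE, sum_I3).
under eq_fun do rewrite mxE.
case: (I3P k) => ->; case: (I3P l) => -> /=;
  rewrite ?partial_cst ?partialN_setT ?partial_sin_coord ?partial_cos_coord /=;
  solve_elementary; ring.
Qed.

Lemma elementary_mx_gam : elementary_mx setT (fun y : 'rV[R]_n => gam (y 0 j)).
Proof.
move=> k l; under eq_fun do rewrite mxE.
by case: (I3P l) => -> /=; solve_elementary.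
Qed.

Lemma partial_gam :
  partial i (fun y => gam (y 0 j)) x = (i == j)%:R *: dgam (x 0 j).
Proof.
rewrite (partial_mxE openT) //; last exact: elementary_mx_gam.
apply/matrixP => k l; rewrite !mxE.
under eq_fun do rewrite mxE.
have e2 : elementary setT (fun y : 'rV[R]_n => 2 * y 0 j) by solve_elementary.
case: (I3P l) => -> /=; rewrite ?partial_cst ?mulr0 //.
  rewrite partialM_setT ?partial_cst; solve_elementary.
  rewrite (partial_sin openT) // partialM_setT ?partial_cst; solve_elementary.
  rewrite partial_coord; ring.
rewrite (partial_cos openT) // partialM_setT ?partial_cst; solve_elementary.
rewrite partial_coord; ring.
Qed.

End Rotation.

Local Notation z := transversal.
Local Notation r := tangential.

Lemma frame_mapE O : frame_map O = fun x : 'rV[R]_4 =>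
  gam (x 0 z) *m rotz (x 0 (r 2%:R)) *m roty (x 0 (r 1)) *m rotx (x 0 (r 0)) *m O.
Proof. by apply/funext => x; rewrite /frame_map /euler !mxE !mulmxA. Qed.

Lemma elementary_frame_map O : elementary_mx setT (@frame_map R O).
Proof.
rewrite frame_mapE; do ![apply: elementary_mx_mul].
- exact: elementary_mx_gam.
- exact: elementary_rotz.
- exact: elementary_roty.
- exact: elementary_rotx.
- exact: elementary_mx_cst.
Qed.

Lemma partial_frame_map O i (x : 'rV[R]_4) : partial i (frame_map O) x =
  ((i == z)%:R *: dgam (x 0 z) *m rotz (x 0 (r 2%:R)) +
   (i == r 2%:R)%:R *: gam (x 0 z) *m (skew (delta_mx 0 2%:R) *m rotz (x 0 (r 2%:R))))
    *m roty (x 0 (r 1)) *m rotx (x 0 (r 0)) *m O +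
  gam (x 0 z) *m rotz (x 0 (r 2%:R)) *m
   ((i == r 1)%:R *: (skew (delta_mx 0 1) *m roty (x 0 (r 1)))) *m rotx (x 0 (r 0)) *m O +
  gam (x 0 z) *m rotz (x 0 (r 2%:R)) *m roty (x 0 (r 1)) *m
   ((i == r 0)%:R *: (skew (delta_mx 0 0) *m rotx (x 0 (r 0)))) *m O.
Proof.
have eg := @elementary_mx_gam 4 z.
have ez := @elementary_rotz 4 (r 2%:R).
have ey := @elementary_roty 4 (r 1).
have ex := @elementary_rotx 4 (r 0).
have egz := elementary_mx_mul eg ez.
have egzy := elementary_mx_mul egz ey.
have egzyx := elementary_mx_mul egzy ex.
rewrite frame_mapE (partial_mulmx openT i I egzyx (elementary_mx_cst _ O)).
rewrite (partial_mulmx openT i I egzy ex) (partial_mulmx openT i I egz ey).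
rewrite (partial_mulmx openT i I eg ez) partial_cst mulmx0 addr0.
rewrite partial_rotx partial_roty partial_rotz partial_gam.
by rewrite !mulmxDl -!scalemxAr -!scalemxAl.
Qed.

Lemma partial_frame_map_transversal O (x : 'rV[R]_4) :
  partial z (frame_map O) x = dgam (x 0 z) *m (euler (tangential_part x) *m O).
Proof.
rewrite partial_frame_map eqxx !scale0r ?mulmx0 ?mul0mx ?addr0 scale1r.
by rewrite /euler !mxE !mulmxA.
Qed.

(** The generator of each elementary rotation is moved to the left past the preceding rotations,
    which rotates its axis. *)
Lemma partial_frame_map_tangential O a (x : 'rV[R]_4) : partial (r a) (frame_map O) x =
  gam (x 0 z) *m skew (row a (euler_velocity (tangential_part x))^T) *m
    (euler (tangential_part x) *m O).
Proof.
rewrite partial_frame_map !eq_tangential /euler !mxE !mulmxA.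
set s := skew (row a _).
have n1 := cos2Dsin2 (x 0 (r 1)).
have n2 := cos2Dsin2 (x 0 (r 2%:R)).
have zero : (r a == z) = false by [].
rewrite zero scale0r !mul0mx add0r.
have es K : a = K -> s = skew (row K (euler_velocity (tangential_part x))^T).
  by rewrite /s => ->.
case: (I3P a) es => -> /(_ _ erefl) -> /=; rewrite !(scale0r, mul0mx, mulmx0, add0r, addr0)
  scale1r.
- rewrite !mulmxA; congr (_ *m _ *m _); rewrite -!mulmxA; congr (_ *m _).
  (* The first axis goes past [roty] and then past [rotz]. The second passage needs cos^2 + sin^2 =
     1 multiplied by the coordinates of the intermediate axis. *)
  transitivity (rotz (x 0 (r 2%:R)) *m
      (skew (\row_j [:: cos (x 0 (r 1)); 0; - sin (x 0 (r 1))]`_j) *m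
       roty (x 0 (r 1)))).
    congr (_ *m _); apply/matrixP => k l; rewrite !(mxE, sum_I3).
    by case: (I3P k) => ->; case: (I3P l) => -> /=; lra.
  rewrite !mulmxA; congr (_ *m _); apply/matrixP => k l; rewrite !(mxE, sum_I3).
  have m1 := congr1 ( *%R (cos (x 0 (r 1)))) n2.
  have m2 := congr1 ( *%R (sin (x 0 (r 1)))) n2.
  by case: (I3P k) => ->; case: (I3P l) => -> /=; lra.
- rewrite !mulmxA; congr (_ *m _ *m _ *m _); rewrite -!mulmxA; congr (_ *m _).
  apply/matrixP => k l; rewrite !(mxE, sum_I3).
  by case: (I3P k) => ->; case: (I3P l) => -> /=; lra.
- suff <- : delta_mx 0 2%:R = row 2%:R (euler_velocity (tangential_part x))^T by [].
  by apply/rowP => k; rewrite !mxE; case: (I3P k) => -> /=.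
Qed.

End FrameMapDerivatives.

(** * Derivatives of the f_K and the zero of the biharmonic polynomial *)

Section RealComputations.
Variable R : realType.

Definition d_orbit_metric (t : R) : 'rV[R]_3 :=
  \row_K [:: - (8 * (cos (2 * t) * sin (2 * t))) / (1 + cos (2 * t) ^+ 2) ^+ 2; 0;
             8 * (cos (2 * t) * sin (2 * t)) / (1 + sin (2 * t) ^+ 2) ^+ 2]`_K.

Definition dd_orbit_metric (t : R) : 'rV[R]_3 :=
  \row_K [:: - (16 * (cos (2 * t) ^+ 2 - sin (2 * t) ^+ 2)) / (1 + cos (2 * t) ^+ 2) ^+ 2
             - 64 * (cos (2 * t) ^+ 2 * sin (2 * t) ^+ 2) / (1 + cos (2 * t) ^+ 2) ^+ 3;
             0;
             16 * (cos (2 * t) ^+ 2 - sin (2 * t) ^+ 2) / (1 + sin (2 * t) ^+ 2) ^+ 2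
             - 64 * (cos (2 * t) ^+ 2 * sin (2 * t) ^+ 2) / (1 + sin (2 * t) ^+ 2) ^+ 3]`_K.

Section Rules.
Variables (t : R) (f h : R -> R) (df dh : R).
Hypotheses (Df : is_derive t 1 f df) (Dh : is_derive t 1 h dh).

Lemma is_derive_add : is_derive t 1 (fun s => f s + h s) (df + dh).
Proof. exact: is_deriveD. Qed.

Lemma is_derive_mul : is_derive t 1 (fun s => f s * h s) (df * h t + f t * dh).
Proof.
by apply: (is_derive_eq (is_deriveM Df Dh)); rewrite addrC [_ *: df]mulrC.
Qed.

Lemma is_derive_div : h t != 0 ->
  is_derive t 1 (fun s => f s / h s) ((df * h t - f t * dh) / h t ^+ 2).
Proof.
move=> h0; have DV := is_deriveV h0 Dh.
apply: (is_derive_eq (is_deriveM Df DV)).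
by rewrite /GRing.scale /=; field.
Qed.

End Rules.

Lemma is_derive_double (t : R) : is_derive t 1 (fun s : R => 2 * s) 2.
Proof.
have D := is_derive_mul (is_derive_cst (2 : R) t 1) (is_derive_id t 1).
by apply: (is_derive_eq D); rewrite mul0r add0r mulr1.
Qed.

Lemma is_derive_sin2 (t : R) : is_derive t 1 (fun s => sin (2 * s)) (2 * cos (2 * t)).
Proof. by have := is_derive1_comp (is_derive_sin (2 * t)) (is_derive_double t); rewrite mulrC. Qed.

Lemma is_derive_cos2 (t : R) :
  is_derive t 1 (fun s => cos (2 * s)) (- (2 * sin (2 * t))).
Proof.
have := is_derive1_comp (is_derive_cos (2 * t)) (is_derive_double t).
by rewrite mulNr mulrC.
Qed.

Lemma sqr1_neq0 (a : R) : 1 + a ^+ 2 != 0.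
Proof. by rewrite gt_eqF // ltr_wpDr // sqr_ge0. Qed.

Lemma is_derive_one_plus_sqr (t : R) (f : R -> R) df : is_derive t 1 f df ->
  is_derive t 1 (fun s => 1 + f s ^+ 2) (2 * f t * df).
Proof.
move=> D; apply: (is_derive_eq (is_derive_add (is_derive_cst (1 : R) t 1)
  (is_derive_mul D D))); ring.
Qed.

Lemma is_derive_orbit_metric (t : R) K :
  is_derive t 1 (fun s => orbit_metric s 0 K) (d_orbit_metric t 0 K).
Proof.
have aux (f : R -> R) df : is_derive t 1 f df ->
    is_derive t 1 (fun s => 2 * f s ^+ 2 / (1 + f s ^+ 2))
                  (4 * f t * df / (1 + f t ^+ 2) ^+ 2).
  move=> D; have D2 := is_derive_mul (is_derive_cst (2 : R) t 1) (is_derive_mul D D).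
  apply: (is_derive_eq (is_derive_div D2 (is_derive_one_plus_sqr D) (sqr1_neq0 _))).
  by have := sqr1_neq0 (f t); move=> f0; field.
under eq_fun do rewrite mxE mxE.
rewrite mxE; case: (I3P K) => -> /=.
- by apply: (is_derive_eq (aux _ _ (is_derive_cos2 t))); congr (_ / _); ring.
- exact: is_derive_cst.
- by apply: (is_derive_eq (aux _ _ (is_derive_sin2 t))); congr (_ / _); ring.
Qed.

Lemma is_derive_d_orbit_metric (t : R) K :
  is_derive t 1 (fun s => d_orbit_metric s 0 K) (dd_orbit_metric t 0 K).
Proof.
have aux (f h : R -> R) df dh k : is_derive t 1 f df -> is_derive t 1 h dh ->
    is_derive t 1 (fun s => k * (f s * h s) / (1 + f s ^+ 2) ^+ 2)
      (k * (df * h t + f t * dh) / (1 + f t ^+ 2) ^+ 2 -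
       k * 4 * f t ^+ 2 * h t * df / (1 + f t ^+ 2) ^+ 3).
  move=> Df Dh.
  have D1 := is_derive_mul (is_derive_cst (k : R) t 1) (is_derive_mul Df Dh).
  have D2 := is_derive_one_plus_sqr Df.
  have f0 := sqr1_neq0 (f t).
  apply: (is_derive_eq (is_derive_div D1 (is_derive_mul D2 D2) (mulf_neq0 f0 f0))).
  by rewrite /=; field.
have Dc := is_derive_cos2 t; have Ds := is_derive_sin2 t.
rewrite mxE; under eq_fun do rewrite mxE.
case: (I3P K) => -> /=.
- under eq_fun do rewrite -mulNr.
  apply: (is_derive_eq (aux _ _ _ _ (- 8) Dc Ds)).
  by have := sqr1_neq0 (cos (2 * t)); move=> f0; field.
- exact: is_derive_cst.
- under eq_fun do rewrite [cos _ * _]mulrC.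
  apply: (is_derive_eq (aux _ _ _ _ 8 Ds Dc)).
  by have := sqr1_neq0 (sin (2 * t)); move=> f0; field.
Qed.

(** With P = y and P = 1 - y for the two varying directions, f'' / f = (P'' (1 + P) - 2 P'^2) / (P
    (1 + P)^2). This is the numerator of the sum over the common denominator, up to the factor 8;
    the first product comes from sin^2, the second from cos^2. *)
Definition biharmonic_polynomial (y : R) : R :=
  (1 - y) * (2 - y) ^+ 2 * ((1 - 2 * y) * (1 + y) - 4 * y * (1 - y)) -
  y * (1 + y) ^+ 2 * ((1 - 2 * y) * (2 - y) + 4 * y * (1 - y)).

Lemma sum_dd_orbit_metric t : sin (2 * t) != 0 -> cos (2 * t) != 0 ->
  \sum_K dd_orbit_metric t 0 K / orbit_metric t 0 K =
  8 * biharmonic_polynomial (sin (2 * t) ^+ 2) /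
  (sin (2 * t) ^+ 2 * cos (2 * t) ^+ 2 * (1 + sin (2 * t) ^+ 2) ^+ 2 *
   (1 + cos (2 * t) ^+ 2) ^+ 2).
Proof.
move=> s0 c0; rewrite sum_I3 !mxE /= /biharmonic_polynomial.
have := sqr1_neq0 (cos (2 * t)); have := sqr1_neq0 (sin (2 * t)).
have := expf_neq0 2 s0; have := expf_neq0 2 c0.
have -> : cos (2 * t) ^+ 2 = 1 - sin (2 * t) ^+ 2.
  exact: cos2sin2.
move: (sin (2 * t) ^+ 2) => S C0 S0 S1 C1.
by field; rewrite C1 S1 C0 S0.
Qed.

(** The sum has the factor cos^2 2t - sin^2 2t, whose zero t = pi / 8 is the minimal orbit. *)
Lemma sum_d_orbit_metric_gt0 t : 0 < sin (2 * t) < cos (2 * t) ->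
  0 < \sum_K d_orbit_metric t 0 K / orbit_metric t 0 K.
Proof.
move=> /andP[s0 sc]; have c0 := lt_trans s0 sc.
have -> : \sum_K d_orbit_metric t 0 K / orbit_metric t 0 K =
  4 * (cos (2 * t) ^+ 2 - sin (2 * t) ^+ 2) *
  (1 + cos (2 * t) ^+ 2 + sin (2 * t) ^+ 2) /
  (cos (2 * t) * sin (2 * t) * (1 + sin (2 * t) ^+ 2) * (1 + cos (2 * t) ^+ 2)).
  rewrite sum_I3 !mxE /=.
  have := sqr1_neq0 (cos (2 * t)); have := sqr1_neq0 (sin (2 * t)).
  have := gt_eqF s0; have := gt_eqF c0.
  move: (sin _) (cos _) => s c /negbT c1 /negbT s1 S1 C1.
  by field; do ?[apply/andP; split].
have sqr_gt0 (x : R) : 0 < 1 + x ^+ 2 by rewrite ltr_wpDr // sqr_ge0.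
rewrite divr_gt0 ?mulr_gt0 //.
  by rewrite subr_gt0 ltrXn2r // ltW.
by rewrite -addrA ltr_wpDr // addr_ge0 // sqr_ge0.
Qed.

Lemma biharmonic_time : exists2 t : R, 0 < t < pi / 8 &
  biharmonic_polynomial (sin (2 * t) ^+ 2) = 0.
Proof.
pose F (t : R) := biharmonic_polynomial (sin (2 * t) ^+ 2).
have pi8 : 0 < pi / 8 :> R by rewrite divr_gt0 // pi_gt0.
have F0 : F 0 = 4 by rewrite /F mulr0 sin0 /biharmonic_polynomial; ring.
have F8 : F (pi / 8) = - 9 / 4.
  have S : sin (2 * (pi / 8)) ^+ 2 = 1 / 2 :> R.
    have e : cos (2 * (pi / 8) + 2 * (pi / 8)) = 0 :> R.
      by rewrite (_ : _ + _ = pi / 2) ?cos_pihalf //; field.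
    have := cos2Dsin2 (2 * (pi / 8) : R); move: e; rewrite cosD; lra.
  by rewrite /F S /biharmonic_polynomial; field.
have polE y : biharmonic_polynomial y =
    ((1 - 'X) * (2%:P - 'X) ^+ 2 *
      ((1 - 2 *: 'X) * (1 + 'X) - 4 *: 'X * (1 - 'X)) -
     'X * (1 + 'X) ^+ 2 *
      ((1 - 2 *: 'X) * (2%:P - 'X) + 4 *: 'X * (1 - 'X))).[y].
  by rewrite !(hornerE, horner_exp) /biharmonic_polynomial /=; ring.
have F_cont : continuous F.
  move=> t; rewrite /F; under eq_fun do rewrite polE.
  apply: (@continuous_comp _ _ _ (fun t : R => sin (2 * t) ^+ 2)).
    apply: differentiable_continuous; apply/derivable1_diffP.
    by have [D _] := is_derive_mul (is_derive_sin2 t) (is_derive_sin2 t).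
  exact: continuous_horner.
have [||t] := @IVT R F 0 (pi / 8) 0 (ltW pi8).
- exact: continuous_subspaceT.
- rewrite F0 F8 ge_min le_max; apply/andP; split; apply/orP; [right|left]; lra.
(* The intermediate value theorem gives a closed interval; the values 4 and -9/4 exclude its
   ends. *)
rewrite in_itv /= => /andP[]; rewrite le_eqVlt => /orP[/eqP <-|t0].
  by rewrite F0 => _ /eqP; rewrite pnatr_eq0.
rewrite le_eqVlt => /orP[/eqP ->|t8]; first by rewrite F8; lra.
by move=> Ft; exists t => //; rewrite t0.
Qed.

End RealComputations.

(** * The chart domain and the metric coefficients in it *)

Section OrbitChart.
Variable R : realType.

Local Notation z := transversal.
Local Notation r := tangential.

(** The bounds on t make sin 2t and cos 2t positive. As 1 <= pi / 2, each angle ranges over an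
    interval where the sine is injective and the cosine positive; this gives injectivity and keeps
    clear of the Euler-angle singularity. *)
Definition chart_domain : set 'rV[R]_4 :=
  [set x | 0 < x 0 z < pi / 4 /\ forall a, -1 < x 0 (r a) < 1].

Lemma open_chart_domain : open chart_domain.
Proof.
have cO i (a b : R) : open [set x : 'rV[R]_4 | a < x 0 i < b].
  apply: (@open_comp _ _ (fun x : 'rV[R]_4 => x 0 i) `]a, b[%classic).
    by move=> x _; exact: coord_continuous.
  exact: itv_open.
rewrite (_ : chart_domain = [set x | 0 < x 0 z < pi / 4] `&`
    ([set x | -1 < x 0 (r 0) < 1] `&` ([set x | -1 < x 0 (r 1) < 1] `&`
     [set x | -1 < x 0 (r 2%:R) < 1]))).
  by do 3?[apply: (@openI 'rV[R]_4); first exact: cO]; exact: cO.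
apply/seteqP; split=> x /=; first by move=> [? h]; do !split=> //.
by move=> [? [? [? ?]]]; split=> // a; case: (I3P a) => ->.
Qed.

Lemma chart_domain_slice t u : chart_domain (slice t u) ->
  0 < t < pi / 4 /\ forall a, -1 < u 0 a < 1.
Proof.
move=> [+ h]; rewrite slice_transversal => t0; split=> // a.
by rewrite -(slice_tangential t).
Qed.

Lemma sin2_gt0 (t : R) : 0 < t < pi / 4 -> 0 < sin (2 * t).
Proof. by move=> /andP[t0 t4]; apply: sin_gt0_pihalf; apply/andP; split; lra. Qed.

Lemma cos2_gt0 (t : R) : 0 < t < pi / 4 -> 0 < cos (2 * t).
Proof. by move=> /andP[t0 t4]; apply: cos_gt0_pihalf; apply/andP; split; lra. Qed.

Lemma cos_coord_gt0 (s : R) : -1 < s < 1 -> 0 < cos s.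
Proof.
move=> /andP[s1 s2]; have := pihalf_ge1 R => p.
by apply: cos_gt0_pihalf; apply/andP; split; lra.
Qed.

Lemma sin_coord_inj (s s' : R) : -1 < s < 1 -> -1 < s' < 1 -> sin s = sin s' -> s = s'.
Proof.
move=> /andP[s1 s2] /andP[s1' s2']; have := pihalf_ge1 R => p.
by apply: sin_inj; rewrite in_itv /=; apply/andP; split; lra.
Qed.

(** The inner product of the two points is invariant under the diagonal action and determines t,
    since 4 t lies in (0, pi); it separates the orbits. *)
Lemma gam_gram (t : R) O : orthogonal_mx O ->
  (gam t *m O *m (gam t *m O)^T) 0 1 = cos (4 * t).
Proof.
move=> OO; rewrite trmx_mul mulmxA -(mulmxA _ O) OO mulmx1.
have -> : 4 * t = 2 * t + 2 * t by ring.
by rewrite cosD !(mxE, sum_I3) /= (@modn_small 1 2) // expr0 expr1; ring.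
Qed.

Lemma gam_orthogonal_inj (t t' : R) O O' : 0 < t < pi / 4 -> 0 < t' < pi / 4 ->
  orthogonal_mx O -> orthogonal_mx O' -> gam t *m O = gam t' *m O' -> t = t'.
Proof.
move=> /andP[t0 t4] /andP[t0' t4'] OO OO' e.
have := gam_gram t OO; rewrite e gam_gram // => /esym ec.
suff : 4 * t = 4 * t' by lra.
by apply: cos_inj; rewrite ?in_itv /= //; apply/andP; split; lra.
Qed.

Definition euler_velocity_inv (u : 'rV[R]_3) : 'M[R]_3 := mx3
  [:: [:: cos (u 0 2%:R) / cos (u 0 1); sin (u 0 2%:R) / cos (u 0 1); 0];
      [:: - sin (u 0 2%:R); cos (u 0 2%:R); 0];
      [:: sin (u 0 1) * (cos (u 0 2%:R) / cos (u 0 1));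
          sin (u 0 1) * (sin (u 0 2%:R) / cos (u 0 1)); 1]].

Lemma euler_velocityK (u : 'rV[R]_3) : cos (u 0 1) != 0 ->
  euler_velocity u *m euler_velocity_inv u = 1%:M.
Proof.
move=> c1; have e2 := cos2Dsin2 (u 0 2%:R).
apply/matrixP => i j; rewrite !(mxE, sum_I3).
move: (cos (u 0 1)) (sin (u 0 1)) c1 e2 => c s c1 e2.
by case: (I3P i) => ->; case: (I3P j) => -> /=;
  first [by field | by transitivity (cos (u 0 2%:R) ^+ 2 + sin (u 0 2%:R) ^+ 2);
                    [field|exact: e2]].
Qed.

Lemma euler_velocity_unit (u : 'rV[R]_3) : cos (u 0 1) != 0 -> euler_velocity u \in unitmx.
Proof. by move=> /euler_velocityK/mulmx1_unit[]. Qed.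

Lemma inv_euler_velocity (u : 'rV[R]_3) : cos (u 0 1) != 0 ->
  invmx (euler_velocity u) = euler_velocity_inv u.
Proof.
move=> c1; rewrite -[RHS](mulKmx (euler_velocity_unit c1)) euler_velocityK //.
by rewrite mulmx1.
Qed.

Lemma elementary_euler_velocity : elementary_mx setT (@euler_velocity R).
Proof.
apply: elementary_mx3 => k l.
by case: (I3P k) => ->; case: (I3P l) => -> /=; solve_elementary.
Qed.

Lemma elementary_euler_velocity_inv (W : set 'rV[R]_3) :
  (forall u, W u -> cos (u 0 1) != 0) -> elementary_mx W euler_velocity_inv.
Proof.
move=> W0; apply: elementary_mx3 => k l.
have eV : elementary W (fun u : 'rV[R]_3 => (cos (u 0 1))^-1).
  by apply: elementaryV => //; solve_elementary.
by case: (I3P k) => ->; case: (I3P l) => -> /=; solve_elementary.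
Qed.

(** By the Maurer-Cartan equations d theta^K is a multiple of the wedge of the two other forms, both
    of which vanish on e_K. *)
Lemma euler_velocity_unimodular (u : 'rV[R]_3) K l : cos (u 0 1) != 0 ->
  \sum_a invmx (euler_velocity u) a K *
    (partial a (fun v => euler_velocity v K l) u -
     partial l (fun v => euler_velocity v K a) u) = 0.
Proof.
move=> c1; rewrite inv_euler_velocity // sum_I3.
have e2 := cos2Dsin2 (u 0 2%:R).
have dE (a : 'I_3) : partial a (@euler_velocity R) u = mx3
  [:: [:: - sin (u 0 1) * (a == 1)%:R * cos (u 0 2%:R) - cos (u 0 1) * (sin (u 0 2%:R) * (a == 2%:R)%:R);
          - (cos (u 0 2%:R) * (a == 2%:R)%:R); 0];
      [:: - sin (u 0 1) * (a == 1)%:R * sin (u 0 2%:R) + cos (u 0 1) * (cos (u 0 2%:R) * (a == 2%:R)%:R);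
         - sin (u 0 2%:R) * (a == 2%:R)%:R; 0];
      [:: - (cos (u 0 1) * (a == 1)%:R); 0; 0]].
  rewrite (partial_mxE openT) //; last exact: elementary_euler_velocity.
  apply/matrixP => k m; rewrite !mxE; under eq_fun do rewrite mxE.
  case: (I3P k) => ->; case: (I3P m) => -> /=;
    rewrite ?partial_cst ?partialM_setT ?partialN_setT ?partial_sin_coord
      ?partial_cos_coord; solve_elementary; ring.
have dK a k m : partial a (fun v => euler_velocity v k m) u =
    partial a (@euler_velocity R) u k m.
  by rewrite (partial_mxE openT) ?mxE //; exact: elementary_euler_velocity.
rewrite !dK !dE !mxE; move: (cos (u 0 1)) (sin (u 0 1)) c1 e2 => c s c1 e2.
by case: (I3P K) => ->; case: (I3P l) => -> /=; field.
Qed.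

Definition orbit_metric_mx (x : 'rV[R]_4) : 'M[R]_3 :=
  (euler_velocity (tangential_part x))^T *m diag_mx (orbit_metric (x 0 z)) *m
  euler_velocity (tangential_part x).

Lemma tangential_part_slice (t : R) u : tangential_part (slice t u) = u.
Proof. by apply/rowP => a; rewrite mxE slice_tangential. Qed.

Lemma orbit_metric_mx_slice t u : orbit_metric_mx (slice t u) =
  (euler_velocity u)^T *m diag_mx (orbit_metric t) *m euler_velocity u.
Proof. by rewrite /orbit_metric_mx tangential_part_slice slice_transversal. Qed.

Lemma elementary_tangential (W : set 'rV[R]_3) f : elementary W f ->
  elementary (@tangential_part R @^-1` W) (fun x => f (tangential_part x)).
Proof.
elim=> {f}.
- by move=> a; exact: elementary_cst.
- move=> j; apply: (elementary_eq _ (elementary_coord _ (r j))) => x _.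
  by rewrite mxE.
- by move=> f h _ ef _ eh; exact: elementaryD.
- by move=> f h _ ef _ eh; exact: elementaryM.
- by move=> f f0 _ ef; apply: elementaryV => // x Wx; exact: f0.
- by move=> f _ ef; exact: elementary_sin.
- by move=> f _ ef; exact: elementary_cos.
- by move=> f h fh _ ef; apply: (elementary_eq _ ef) => x Wx; exact: fh.
Qed.

Lemma elementary_subset n (U W : set 'rV[R]_n) f :
  U `<=` W -> elementary W f -> elementary U f.
Proof.
move=> UW; elim=> {f}.
- by move=> a; exact: elementary_cst.
- by move=> j; exact: elementary_coord.
- by move=> f h _ ef _ eh; exact: elementaryD.
- by move=> f h _ ef _ eh; exact: elementaryM.
- by move=> f f0 _ ef; apply: elementaryV => // x Ux; exact/f0/UW.
- by move=> f _ ef; exact: elementary_sin.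
- by move=> f _ ef; exact: elementary_cos.
- by move=> f h fh _ ef; apply: (elementary_eq _ ef) => x Ux; exact/fh/UW.
Qed.

Local Notation U := chart_domain.

Lemma chart_domain_cos x : U x -> cos (tangential_part x 0 1) != 0.
Proof. by move=> [_ /(_ 1)]; rewrite mxE => /cos_coord_gt0/gt_eqF ->. Qed.

Lemma orbit_metric_gt0 (t : R) K : 0 < t < pi / 4 -> 0 < orbit_metric t 0 K.
Proof.
move=> t4; have s0 := sin2_gt0 t4; have c0 := cos2_gt0 t4.
have P0 : 0 < orbit_coef t 0 K.
  by rewrite mxE; case: (I3P K) => -> /=; rewrite ?exprn_gt0.
by rewrite mxE divr_gt0 ?mulr_gt0 ?addr_gt0.
Qed.

Lemma elementary_orbit_metric K : elementary U (fun x => orbit_metric (x 0 z) 0 K).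
Proof.
have e2 : elementary U (fun x => 2 * x 0 z) by solve_elementary.
have eP : elementary U (fun x => orbit_coef (x 0 z) 0 K).
  apply: (elementary_eq (f := fun x => [:: cos (2 * x 0 z) * cos (2 * x 0 z); 1;
    sin (2 * x 0 z) * sin (2 * x 0 z)]`_K)).
    by move=> x _; rewrite mxE expr2.
  by case: (I3P K) => -> /=; solve_elementary.
apply: (elementary_eq (f := fun x => 2 * orbit_coef (x 0 z) 0 K *
    (1 + orbit_coef (x 0 z) 0 K)^-1)).
  by move=> x _; rewrite [RHS]mxE.
apply: elementaryM; first by apply: elementaryM => //; exact: elementary_cst.
apply: elementaryV => [x _|]; first exact: orbit_coef1_neq0.
by apply: elementaryD => //; exact: elementary_cst.
Qed.

Lemma elementary_orbit_metric_mx : elementary_mx U orbit_metric_mx.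
Proof.
have eT : elementary_mx U (fun x => euler_velocity (tangential_part x)).
  move=> i j; apply: elementary_subset (elementary_tangential (elementary_euler_velocity i j)).
  by [].
apply: elementary_mx_mul => //; apply: elementary_mx_mul.
  by move=> i j; apply: (elementary_eq _ (eT j i)) => x _; rewrite [RHS]mxE.
move=> i j; have [->|ij] := eqVneq i j.
  apply: (elementary_eq _ (elementary_orbit_metric j)) => x _.
  by rewrite [RHS]mxE eqxx.
apply: (elementary_eq _ (elementary_cst _ 0)) => x _.
by rewrite [RHS]mxE (negbTE ij).
Qed.

(** An explicit inverse, from which the entries of the inverse metric are seen to be elementary on
    the domain. *)
Lemma inv_orbit_metric_mx x : U x -> invmx (orbit_metric_mx x) =
  euler_velocity_inv (tangential_part x) *m
  diag_mx (\row_K (orbit_metric (x 0 z) 0 K)^-1) *m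
  (euler_velocity_inv (tangential_part x))^T.
Proof.
move=> Ux; have c1 := chart_domain_cos Ux.
have EK := euler_velocityK c1; have KE := mulmx1C EK.
set E := euler_velocity_inv _ in EK KE *.
set T := euler_velocity _ in EK KE *.
have DD : diag_mx (orbit_metric (x 0 z)) *m
    diag_mx (\row_K (orbit_metric (x 0 z) 0 K)^-1) = 1%:M.
  rewrite mulmx_diag -diag_const_mx; congr diag_mx; apply/rowP => K.
  rewrite [LHS]mxE [X in _ * X]mxE [RHS]mxE mulfV //.
  by rewrite gt_eqF // orbit_metric_gt0 //; case: Ux.
have HI : orbit_metric_mx x *m (E *m diag_mx (\row_K (orbit_metric (x 0 z) 0 K)^-1)
    *m E^T) = 1%:M.
  rewrite /orbit_metric_mx -/T !mulmxA -(mulmxA _ T E) EK mulmx1.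
  by rewrite -(mulmxA T^T) DD mulmx1 -trmx_mul KE trmx1.
have [hu _] := mulmx1_unit HI.
by rewrite -[RHS](mulKmx hu) HI mulmx1.
Qed.

Lemma elementary_inv_orbit_metric_mx :
  elementary_mx U (fun x => invmx (orbit_metric_mx x)).
Proof.
pose W : set 'rV[R]_3 := [set u | cos (u 0 1) != 0].
have eE : elementary_mx U (fun x => euler_velocity_inv (tangential_part x)).
  move=> i j; have := @elementary_euler_velocity_inv W (fun u Wu => Wu) i j.
  move=> /elementary_tangential; apply: elementary_subset => x.
  exact: chart_domain_cos.
have e : elementary_mx U (fun x => euler_velocity_inv (tangential_part x) *m
    diag_mx (\row_K (orbit_metric (x 0 z) 0 K)^-1) *m
    (euler_velocity_inv (tangential_part x))^T).
  apply: elementary_mx_mul; last first.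
    by move=> i j; apply: (elementary_eq _ (eE j i)) => x _; rewrite [RHS]mxE.
  apply: elementary_mx_mul => // i j; have [->|ij] := eqVneq i j.
    have eV : elementary U (fun x => (orbit_metric (x 0 z) 0 j)^-1).
      apply: elementaryV; last exact: elementary_orbit_metric.
      by move=> x [/(orbit_metric_gt0 j) f0 _]; rewrite gt_eqF.
    by apply: (elementary_eq _ eV) => x _; rewrite [RHS]mxE eqxx [RHS]mxE.
  apply: (elementary_eq _ (elementary_cst _ 0)) => x _.
  by rewrite [RHS]mxE (negbTE ij).
move=> i j; apply: (elementary_eq _ (e i j)) => x Ux.
by rewrite inv_orbit_metric_mx.
Qed.

Lemma frame_map_coefficients (g : R -> metric R) O x :
  cheeger_deformation g -> orthogonal_mx O ->
  coefficients (g 1) (frame_map O) x =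
  block_mx (8%:M : 'M[R]_1) 0 0 (orbit_metric_mx x).
Proof.
move=> hg OO.
have EO := orthogonalM (euler_orthogonal (tangential_part x)) OO.
apply/matrixP => i j; rewrite mxE.
have [->|[a ->]] := I4P i; have [->|[b ->]] := I4P j;
  rewrite ?partial_frame_map_transversal ?partial_frame_map_tangential.
- rewrite [RHS](@block_mxEul _ 1 3 1 3) mxE eqxx.
  exact: cheeger_dgam_dgam.
- rewrite [RHS](@block_mxEur _ 1 3 1 3) mxE.
  by have [] := cheeger_dgam_skew hg (x 0 z) (row b (euler_velocity (tangential_part x))^T) EO.
- rewrite [RHS](@block_mxEdl _ 1 3 1 3) mxE.
  by have [] := cheeger_dgam_skew hg (x 0 z) (row a (euler_velocity (tangential_part x))^T) EO.
- rewrite [RHS](@block_mxEdr _ 1 3 1 3) cheeger_skew_skew // mxE.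
  apply: eq_bigr => K _; rewrite mul_mx_diag.
  rewrite [row a _ _ _]mxE [row b _ _ _]mxE [in RHS]mxE ![(euler_velocity _)^T _ _]mxE.
  by rewrite [orbit_metric _ _ _ * _]mulrC.
Qed.

End OrbitChart.

(** * Slice charts around every point of an orbit *)

Section SliceChart.
Variable R : realType.

Local Notation z := transversal.
Local Notation r := tangential.
Local Notation U := (@chart_domain R).

Lemma S2xS2_frame_map O (x : 'rV[R]_4) : orthogonal_mx O -> S2xS2 (frame_map O x).
Proof.
move=> OO; apply: S2xS2_orthogonal; last exact: S2xS2_gam.
by apply: orthogonalM => //; exact: euler_orthogonal.
Qed.

(** The two rows of [gam t] span the plane of the first and third axes, so a rotation is seen only
    through its first and third rows. *)
Lemma gam_mul_inj (t : R) (A B : 'M[R]_3) : 0 < t < pi / 4 ->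
  gam t *m A = gam t *m B -> forall j, A 0 j = B 0 j /\ A 2%:R j = B 2%:R j.
Proof.
move=> t4 e j; have s0 := sin2_gt0 t4; have c0 := cos2_gt0 t4.
have e0 := congr1 (fun M : 'M[R]_(2, 3) => M 0 j) e.
have e1 := congr1 (fun M : 'M[R]_(2, 3) => M 1 j) e.
rewrite !(mxE, sum_I3) /= ?(@modn_small 1 2) // expr0 expr1 in e0 e1.
split; [apply: (mulfI (lt0r_neq0 s0))|apply: (mulfI (lt0r_neq0 c0))]; lra.
Qed.

Lemma euler_inj (u v : 'rV[R]_3) :
  (forall a, -1 < u 0 a < 1) -> (forall a, -1 < v 0 a < 1) ->
  (forall j, euler u 0 j = euler v 0 j /\ euler u 2%:R j = euler v 2%:R j) -> u = v.
Proof.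
move=> hu hv e.
have [e00 e20] := e 0; have [e01 e21] := e 1; have [e02 _] := e 2%:R.
rewrite /euler !(mxE, sum_I3) /= in e00 e01 e02 e20 e21.
have h1 : u 0 1 = v 0 1 by apply: sin_coord_inj => //; lra.
have c1 := cos_coord_gt0 (hv 1); rewrite h1 in e00 e01 e02 e20 e21.
have h0 : u 0 0 = v 0 0.
  by apply: sin_coord_inj => //; apply: (mulfI (lt0r_neq0 c1)); lra.
have n0 := cos2Dsin2 (v 0 0); rewrite h0 in e01 e02.
have h2 : u 0 2%:R = v 0 2%:R.
  apply: sin_coord_inj => //.
  (* The first two angles now agree. In the first row of [euler], the cosine of the first angle
     times the second entry minus its sine times the third is minus the sine of the last angle. *)
  have m1 := congr1 ( *%R (sin (u 0 2%:R))) n0.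
  have m2 := congr1 ( *%R (sin (v 0 2%:R))) n0.
  have k1 := congr1 ( *%R (cos (v 0 0))) e01.
  have k2 := congr1 ( *%R (sin (v 0 0))) e02.
  by move: m1 m2 k1 k2; lra.
by apply/rowP => a; case: (I3P a) => ->.
Qed.

Lemma frame_map_inj O x y : orthogonal_mx O -> U x -> U y ->
  frame_map O x = frame_map O y -> x = y.
Proof.
move=> OO [x0 hx] [y0 hy] e.
have xy : x 0 z = y 0 z.
  by apply: gam_orthogonal_inj e => //; apply: orthogonalM => //;
    exact: euler_orthogonal.
have : gam (y 0 z) *m euler (tangential_part x) =
    gam (y 0 z) *m euler (tangential_part y).
  have := congr1 (mulmx^~ O^T) e; rewrite /frame_map xy -!mulmxA OO.
  by rewrite !mulmx1 !mulmxA.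
move=> /(gam_mul_inj y0) E.
have {}E : tangential_part x = tangential_part y.
  by apply: euler_inj E => a; rewrite mxE.
apply/rowP => i; have [->//|[a ->]] := I4P i.
by have /rowP/(_ a) := E; rewrite !mxE.
Qed.

(** A combination of the partial derivatives is a multiple of the velocity plus the action field of
    a total angular velocity w. Both must vanish because sin 2t and cos 2t are nonzero, and w = 0
    forces the coefficients to vanish by invertibility of [euler_velocity]. *)
Lemma frame_map_immersion O x (c : 'rV[R]_4) : orthogonal_mx O -> U x ->
  \sum_i c 0 i *: partial i (frame_map O) x = 0 -> c = 0.
Proof.
move=> OO Ux; rewrite sum_I4 partial_frame_map_transversal.
under eq_bigr do rewrite partial_frame_map_tangential.
set E := _ *m O; set T := euler_velocity _.
have EO : orthogonal_mx E by apply: orthogonalM => //; exact: euler_orthogonal.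
pose w := tangential_part c *m T^T.
have -> : \sum_a c 0 (r a) *: (gam (x 0 z) *m skew (row a T^T) *m E) =
    gam (x 0 z) *m skew w *m E.
  have -> : skew w = \sum_a c 0 (r a) *: skew (row a T^T).
    apply/matrixP => k l; rewrite summxE sum_I3.
    rewrite !(mxE, sum_I3).
    by case: (I3P k) => ->; case: (I3P l) => -> /=; ring.
  rewrite mulmx_sumr mulmx_suml; apply: eq_bigr => a _.
  by rewrite -scalemxAr -scalemxAl.
rewrite scalemxAl -mulmxDl => /(congr1 (mulmx^~ E^T)).
rewrite -mulmxA EO mulmx1 mul0mx => e.
have [t4 _] := Ux; have s0 := lt0r_neq0 (sin2_gt0 t4).
have c0 := lt0r_neq0 (cos2_gt0 t4).
have ee i j := congr1 (fun M : 'M[R]_(2, 3) => M i j) e.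
have e00 := ee 0 0; have e10 := ee 1 0; have e01 := ee 0 1; have e11 := ee 1 1.
have e02 := ee 0 2%:R; have e12 := ee 1 2%:R.
have [cz w0] : c 0 z = 0 /\ w = 0.
  clear e ee; clearbody w.
  rewrite !(mxE, sum_I3) /= ?(@modn_small 1 2) // expr0 expr1
    in e00 e10 e01 e11 e02 e12.
  split; first by apply: (mulfI c0); lra.
  apply/rowP => K; rewrite mxE; case: (I3P K) => ->.
  - by apply: (mulfI c0); lra.
  - by apply: (mulfI c0); lra.
  - by apply: (mulfI s0); lra.
have TT : T^T \in unitmx.
  by rewrite unitmx_tr euler_velocity_unit //; exact: chart_domain_cos.
have ct : tangential_part c = 0 by rewrite -(mulmxK TT (tangential_part c)) -/w w0 mul0mx.
apply/rowP => i; rewrite [RHS]mxE; have [->//|[a ->]] := I4P i.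
by have /rowP/(_ a) := ct; rewrite !mxE.
Qed.

Lemma chart_frame_map O : orthogonal_mx O -> chart U (frame_map O).
Proof.
move=> OO; split.
- exact: open_chart_domain.
- apply: (elementary_mx_smooth (@open_chart_domain R)) => i j.
  apply: elementary_subset (elementary_frame_map O i j).
  by [].
- by move=> x _; exact: S2xS2_frame_map.
- by move=> x y; exact: frame_map_inj.
- by move=> x Ux c; exact: frame_map_immersion.
Qed.

Lemma su2_orbit_frame_map a O c x : SU2 a -> (forall p, su2_act a p = p *m O) ->
  orthogonal_mx O -> 0 < c < pi / 4 -> U x ->
  (su2_orbit (normal_geodesic c) (frame_map O x) <-> x 0 z = c).
Proof.
move=> Sa aE OO c4 [x4 _]; rewrite normal_geodesicE; split=> [[b Sb]|<-].
  have [B OB ->] := su2_act_orthogonal Sb => /esym e.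
  apply: gam_orthogonal_inj e => //.
  by apply: orthogonalM => //; exact: euler_orthogonal.
have [b Sb bE] := euler_su2_act (tangential_part x).
exists (a *m b); first exact: SU2M.
by rewrite su2_actM // aE bE /frame_map mulmxA.
Qed.

Lemma slice_chart_frame_map a O c : SU2 a -> (forall p, su2_act a p = p *m O) ->
  orthogonal_mx O -> 0 < c < pi / 4 ->
  slice_chart (su2_orbit (normal_geodesic c)) U (frame_map O) c.
Proof.
move=> Sa aE OO c4; split; first exact: chart_frame_map.
move=> x Ux; rewrite (_ : 0 = z :> 'I_4); last exact/val_inj.
exact: (su2_orbit_frame_map Sa).
Qed.

Lemma chart_domain_slice0 (c : R) : 0 < c < pi / 4 -> U (slice c 0).
Proof.
move=> c4; split=> [|a]; first by rewrite slice_transversal.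
by rewrite slice_tangential mxE ltrN10 ltr01.
Qed.

Lemma frame_map_slice0 O (c : R) : frame_map O (slice c 0) = gam c *m O.
Proof.
rewrite /frame_map slice_transversal tangential_part_slice.
suff -> : euler 0 = 1%:M :> 'M[R]_3 by rewrite mul1mx.
apply/matrixP => i j; rewrite !(mxE, sum_I3) /= !(mxE, sin0, cos0).
by case: (I3P i) => ->; case: (I3P j) => -> /=; ring.
Qed.

Section Tensions.
Variables (g : R -> metric R) (hg : cheeger_deformation g).
Variables (O : 'M[R]_3) (c : R).
Hypothesis OO : orthogonal_mx O.

Let gE x : U x -> coefficients (g 1) (frame_map O) x =
  block_mx (8%:M : 'M[R]_1) 0 0 (orbit_metric_mx x).
Proof. by move=> _; exact: frame_map_coefficients. Qed.

Let hE t u : U (slice t u) -> orbit_metric_mx (slice t u) =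
  (euler_velocity u)^T *m diag_mx (orbit_metric t) *m euler_velocity u.
Proof. by move=> _; exact: orbit_metric_mx_slice. Qed.

Let cos_slice (t : R) u : U (slice t u) -> cos (u 0 1) != 0.
Proof. by move=> /chart_domain_cos; rewrite tangential_part_slice. Qed.

Let theta_unit (t : R) u : U (slice t u) -> euler_velocity u \in unitmx.
Proof. by move=> /cos_slice; exact: euler_velocity_unit. Qed.

Let f_neq0 t (u : 'rV[R]_3) K : U (slice t u) -> orbit_metric t 0 K != 0.
Proof. by move=> /chart_domain_slice[t4 _]; rewrite gt_eqF // orbit_metric_gt0. Qed.

Let eight_neq0 : 8 != 0 :> R. Proof. by rewrite pnatr_eq0. Qed.

Lemma orbit_tension u : U (slice c u) ->
  tension (coefficients (g 1) (frame_map O)) (slice c) u =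
  (- (2 * 8)^-1 * \sum_K d_orbit_metric c 0 K / orbit_metric c 0 K) *:
    delta_mx 0 z.
Proof.
exact: (frame_tension (@open_chart_domain R) eight_neq0 gE hE theta_unit f_neq0
  (@is_derive_orbit_metric R)).
Qed.

Lemma orbit_bitension u :
  \sum_K dd_orbit_metric c 0 K / orbit_metric c 0 K = 0 -> U (slice c u) ->
  bitension (coefficients (g 1) (frame_map O)) (slice c) u = 0.
Proof.
apply: (frame_bitension (@open_chart_domain R) eight_neq0 gE hE
  (@elementary_euler_velocity R) theta_unit f_neq0
  (@is_derive_orbit_metric R) (@is_derive_d_orbit_metric R)).
- by move=> t v K l /cos_slice; exact: euler_velocity_unimodular.
- exact: elementary_orbit_metric_mx.
- exact: elementary_inv_orbit_metric_mx.
Qed.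

End Tensions.

End SliceChart.

Theorem mainTheorem4 (R : realType) (g : R -> metric R)
    (hg : cheeger_deformation g) :
  exists t : R, 0 < t < pi / 8 /\
    proper_biharmonic_hypersurface (g 1) (su2_orbit (normal_geodesic t)).
Proof.
have [t t8 Pt] := biharmonic_time R.
exists t; split=> //; have /andP[t0 t1] := t8.
have t4 : 0 < t < pi / 4 by apply/andP; split; lra.
have s0 := sin2_gt0 t4; have c0 := cos2_gt0 t4.
split.
  move=> _ [a Sa <-]; have [B OB aE] := su2_act_orthogonal Sa.
  (* The rotation B carries the chart from the normal geodesic to the given point, which has Euler
     angles 0. *)
  exists (@chart_domain R), (frame_map B), t; split.
  - exact: slice_chart_frame_map aE OB t4.
  - exists 0; first exact: chart_domain_slice0.
    by rewrite frame_map_slice0 normal_geodesicE aE.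
  - move=> u; apply: orbit_bitension => //.
    by rewrite sum_dd_orbit_metric ?gt_eqF // Pt mulr0 mul0r.
have SU1 : SU2 (1%:M : 'M[R[i]%C]_2).
  by split; [rewrite trmx1 map_mx1 mulmx1|exact: det1].
have O1 : orthogonal_mx (1%:M : 'M[R]_3) by rewrite /orthogonal_mx trmx1 mulmx1.
exists (@chart_domain R), (frame_map 1%:M), t, 0; split.
- apply: slice_chart_frame_map SU1 _ O1 t4 => p.
  by rewrite su2_act1 mulmx1.
- exact: chart_domain_slice0.
rewrite orbit_tension //; last exact: chart_domain_slice0.
rewrite scaler_eq0 mulf_eq0 oppr_eq0 invr_eq0 gt_eqF //= gt_eqF /=.
  apply/eqP => /rowP/(_ transversal)/eqP.
  by rewrite !mxE !eqxx oner_eq0.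
apply: sum_d_orbit_metric_gt0; rewrite s0 /=.
(* sin 2t = cos (pi / 2 - 2t), and the cosine decreases on [0, pi]; the inequality 2t < pi / 2 - 2t
   is t < pi / 8. *)
rewrite -cosBpihalf -cosN ltr_cos ?in_itv /=; last 2 first.
- by apply/andP; split; lra.
- by apply/andP; split; lra.
lra.
Qed.
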